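(* Let $k\ge2$ be a fixed integer. Then: (a) $\{\binom{(k+1)n}{n}\}_{n=0}^\infty$ is an infinitely divisible Stieltjes moment sequence. (b) For each real $c>0$, the power sequence $\{\binom{(k+1)n}{n}^c\}_{n=0}^\infty$ is Stieltjes determinate. (c) For each real $c>0$, the (unique) measure $\mu_{k,c}$ on $[0,\infty)$ with moment sequence $\{\binom{(k+1)n}{n}^c\}_{n=0}^\infty$ has Mellin transform $$\int_0^\infty t^s\,d\mu_{k,c}(t)=\left(\frac{\Gamma((k+1)s+1)}{\Gamma(s+1)\Gamma(ks+1)}\right)^c,\quad s\ge0.$$
   Context: A real sequence $\{m_n\}_{n=0}^\infty$ is a Stieltjes moment sequence if there is a nonnegative measure $\mu$ on $[0,\infty)$ with $m_n=\int_{[0,\infty)}x^n\,d\mu(x)$ for all $n\ge0$; it is Stieltjes determinate if such $\mu$ is unique. A Stieltjes moment sequence $\{m_n\}$ is infinitely divisible (in the sense of Tyan) if $\{m_n^c\}_{n=0}^\infty$ is a Stieltjes moment sequence for every real $c>0$. *)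

(* Defs.v *)
From mathcomp Require Import all_boot all_order all_algebra.
From mathcomp Require Import all_classical all_reals all_analysis.

Set Implicit Arguments.
Unset Strict Implicit.
Unset Printing Implicit Defensive.

Import Order.TTheory GRing.Theory Num.Theory.

Local Open Scope classical_set_scope.
Local Open Scope ring_scope.

(* Borel measures on [0, +oo[ are encoded as Borel measures on the real line
   giving no mass to ]-oo, 0[. *)
Definition stieltjes_represents (R : realType)
    (mu : {measure set (measurableTypeR R) -> \bar R}) (m : nat -> R) : Prop :=
  mu `]-oo, 0[%classic = 0%E /\
  forall n : nat, (\int[mu]_(x in `[0%R, +oo[) (x ^+ n)%:E = (m n)%:E)%E.

Definition stieltjes_moment_sequence (R : realType) (m : nat -> R) : Prop :=
  exists mu : {measure set (measurableTypeR R) -> \bar R},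
    stieltjes_represents mu m.

(* Uniqueness is equality on Borel sets, because a {measure set _ -> _} also
   carries unconstrained values on non-measurable sets. *)
Definition stieltjes_determinate (R : realType) (m : nat -> R) : Prop :=
  stieltjes_moment_sequence m /\
  forall mu nu : {measure set (measurableTypeR R) -> \bar R},
    stieltjes_represents mu m -> stieltjes_represents nu m ->
    forall A : set (measurableTypeR R), measurable A -> mu A = nu A.

Definition infinitely_divisible_stieltjes (R : realType) (m : nat -> R) : Prop :=
  stieltjes_moment_sequence m /\
  forall c : R, 0 < c -> stieltjes_moment_sequence (fun n => m n `^ c).

(* Euler's integral, meaningful for 0 < x; the junk value of [Rintegral] on
   divergent integrals only concerns x <= 0. *)
Definition Gamma (R : realType) (x : R) : R :=
  Rintegral (@lebesgue_measure R) `]0, +oo[%classic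
    (fun t => t `^ (x - 1) * expR (- t)).

Definition binom_seq (R : realType) (k : nat) : nat -> R :=
  fun n => ('C(k.+1 * n, n))%:R.

(* Main.v *)
(* Write R(s) = Gamma((k+1)s+1) / (Gamma(s+1) Gamma(ks+1)) and
   M = (k+1)^(k+1) / k^k.  The functional equation of Gamma together with
   Gamma(x+s) ~ x^s Gamma(x) gives a product formula
     R(s) / M^s = lim_N prod_(m < N) prod_(1 <= j <= k)
                    const * (s + m + j/k) / (s + m + j/(k+1)).
   As j/(k+1) <= j/k, every factor is the exponential of a completely monotone
   function plus a constant, so for c > 0 and h >= 0 the sequence
   n |-> (R(nh) / M^(nh))^c is completely monotone and, by Hausdorff's theorem,
   is the moment sequence of a measure on [0, 1].  Taking h = 1/q and pushing
   forward along x |-> M^c x^q yields a measure with moments R(n)^c whose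
   Mellin transform is R^c at the multiples of 1/q.  A moment sequence with
   geometric growth is determinate, because its representing measures live on a
   common compact interval, where (1 - (t/B)^(2N))^floor(N (B/x)^(2N)) tends
   to the indicator of t < x.  Hence all those measures coincide, which gives
   the Mellin transform at the rationals; monotonicity of R(s) / M^s and
   dominated convergence extend it to all s >= 0. *)
From HB Require Import structures.
Require Import Defs.
From mathcomp Require Import all_boot all_order all_algebra.
From mathcomp Require Import all_classical all_reals all_analysis.
From mathcomp Require Import measurable_realfun ring lra.

Set Implicit Arguments.
Unset Strict Implicit.
Unset Printing Implicit Defensive.

Import Order.TTheory GRing.Theory Num.Theory.
Import numFieldNormedType.Exports.

Local Open Scope classical_set_scope.
Local Open Scope ring_scope.

(** * Completely monotone sequences *)

Section completely_monotone.
Variable R : realType.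
Implicit Types (u v : nat -> R) (a b c h x : R).

(** The sign is opposite to that of the usual forward difference, so that complete monotonicity
    reads as nonnegativity of all iterates. *)
Definition nabla u : nat -> R := fun n => u n - u n.+1.
Definition shift u : nat -> R := fun n => u n.+1.
Definition cmono u := forall j n, 0 <= iter j nabla u n.

Lemma eq_nabla_iter u v j n :
  (forall i, u i = v i) -> iter j nabla u n = iter j nabla v n.
Proof. by move=> uv; rewrite (_ : u = v)//; apply/funext. Qed.

Lemma cmono_ge0 u n : cmono u -> 0 <= u n.
Proof. by move=> /(_ 0%N n). Qed.

Lemma cmono_nabla u : cmono u -> cmono (nabla u).
Proof. by move=> cu j n; rewrite -iterSr. Qed.

Lemma nabla_shift u : nabla (shift u) = shift (nabla u).
Proof. by []. Qed.

Lemma cmono_shift u : cmono u -> cmono (shift u).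
Proof.
move=> cu j n; have -> : iter j nabla (shift u) = shift (iter j nabla u).
  by elim: j => //= j ->.
exact: cu.
Qed.

Lemma cmono_le0 u n : cmono u -> u n <= u 0%N.
Proof.
move=> cu; elim: n => // n; apply: le_trans.
by have := cu 1%N n; rewrite /= /nabla subr_ge0.
Qed.

Lemma cmono_cst c : 0 <= c -> cmono (fun=> c).
Proof.
move=> c0 [|j] n //; rewrite iterSr.
have -> : nabla (fun=> c) = fun=> 0 by apply/funext => m; rewrite /nabla subrr.
suff -> : iter j nabla (fun=> 0) = fun=> 0 by [].
by elim: j => //= j ->; apply/funext => m; rewrite /nabla subrr.
Qed.

Lemma nabla_iterD u v j n :
  iter j nabla (fun i => u i + v i) n = iter j nabla u n + iter j nabla v n.
Proof. by elim: j n => //= j IH n; rewrite /nabla !IH; ring. Qed.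

Lemma nabla_iterZ c u j n :
  iter j nabla (fun i => c * u i) n = c * iter j nabla u n.
Proof. by elim: j n => //= j IH n; rewrite /nabla !IH mulrBr. Qed.

Lemma cmonoD u v : cmono u -> cmono v -> cmono (fun n => u n + v n).
Proof. by move=> cu cv j n; rewrite nabla_iterD addr_ge0. Qed.

Lemma cmonoZ c u : 0 <= c -> cmono u -> cmono (fun n => c * u n).
Proof. by move=> c0 cu j n; rewrite nabla_iterZ mulr_ge0. Qed.

(** Leibniz rule [nabla (u v) = nabla u * v + shift u * nabla v], by induction on the order for all
    pairs at once. *)
Lemma cmonoM u v : cmono u -> cmono v -> cmono (fun n => u n * v n).
Proof.
move=> cu cv j; elim: j u v cu cv => [|j IH] u v cu cv n.
  by rewrite mulr_ge0// cmono_ge0.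
rewrite iterSr (@eq_nabla_iter _ (fun n => nabla u n * v n + shift u n * nabla v n)).
  rewrite nabla_iterD addr_ge0//; apply: IH => //.
  - exact: cmono_nabla.
  - exact: cmono_shift.
  - exact: cmono_nabla.
by move=> i; rewrite /nabla /shift; ring.
Qed.

Lemma cmonoX u m : cmono u -> cmono (fun n => u n ^+ m).
Proof.
move=> cu; elim: m => [|m IH]; first exact: cmono_cst.
have -> : (fun n => u n ^+ m.+1) = fun n => u n * u n ^+ m.
  by apply/funext => n; rewrite exprS.
exact: cmonoM.
Qed.

Lemma cmono_sum (I : Type) (r : seq I) (f : I -> nat -> R) :
  (forall i, cmono (f i)) -> cmono (fun n => \sum_(i <- r) f i n).
Proof.
move=> cf; elim: r => [|i r IH].
  by under eq_fun do rewrite big_nil; exact: cmono_cst.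
by under eq_fun do rewrite big_cons; exact: cmonoD.
Qed.

Lemma cmono_prod (I : Type) (r : seq I) (f : I -> nat -> R) :
  (forall i, cmono (f i)) -> cmono (fun n => \prod_(i <- r) f i n).
Proof.
move=> cf; elim: r => [|i r IH].
  by under eq_fun do rewrite big_nil; exact: cmono_cst.
by under eq_fun do rewrite big_cons; exact: cmonoM.
Qed.

Lemma cmono_cvg (f : nat -> nat -> R) u : (forall N, cmono (f N)) ->
  (forall n, f N n @[N --> \oo] --> u n) -> cmono u.
Proof.
move=> cf fu j n.
have {}fu : iter j nabla (f N) n @[N --> \oo] --> iter j nabla u n.
  by elim: j n => //= j IH n; apply: cvgB; exact: IH.
rewrite -(cvg_lim _ fu)//; apply: limr_ge; first by apply/cvg_ex; eexists; exact: fu.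
by apply: nearW => N; exact: cf.
Qed.

(** The partial sums of the exponential series have nonnegative coefficients, so they preserve
    complete monotonicity, which survives pointwise limits. *)
Lemma cmono_expR u : cmono u -> cmono (fun n => expR (u n)).
Proof.
move=> cu; apply: (@cmono_cvg (fun N n => series (exp_coeff (u n)) N)).
  move=> N; rewrite /series/=; apply: cmono_sum => i.
  have -> : (fun n => exp_coeff (u n) i) = fun n => (i`!%:R)^-1 * u n ^+ i.
    by apply/funext => n; rewrite /exp_coeff/= mulrC.
  by apply: cmonoZ; [rewrite invr_ge0|exact: cmonoX].
by move=> n; exact: is_cvg_series_exp_coeff.
Qed.

(** The j-th difference has a closed form with nonnegative factors, the discrete analogue of j! /
    x^(j+1). *)
Lemma cmono_inv x h : 0 < x -> 0 <= h -> cmono (fun n => (x + n%:R * h)^-1).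
Proof.
move=> x0 h0 j.
suff jE n : iter j nabla (fun n => (x + n%:R * h)^-1) n =
    j`!%:R * h ^+ j * \prod_(i < j.+1) (x + (n + i)%:R * h)^-1.
  move=> n; rewrite jE mulr_ge0 ?mulr_ge0 ?exprn_ge0// prodr_ge0// => i _.
  by rewrite invr_ge0 addr_ge0 ?mulr_ge0// ltW.
have p m : x + m%:R * h != 0.
  by rewrite gt_eqF// ltr_wpDr// mulr_ge0.
elim: j n => [|j IH] n.
  by rewrite big_ord_recr big_ord0/= addn0 expr0 !mul1r.
(* The first factor is split off one product and the last off the other; the common middle part is
   [P]. *)
rewrite iterS {1}/nabla !IH [in LHS]big_ord_recl [X in _ - _ * X]big_ord_recr/=.
rewrite [in RHS]big_ord_recr big_ord_recl/=.
under [in X in X - _]eq_bigr do rewrite /bump/= add1n addnS -addSn.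
under [in RHS]eq_bigr do rewrite /bump/= add1n addnS -addSn.
set P := \prod_(i < j) _.
have := p n; have := p (n.+1 + j)%N; rewrite addn0 addSn -addnS.
rewrite factS natrM exprS.
rewrite natrD -[j.+1%:R]natr1 => p1 p2.
by field; rewrite p1 p2.
Qed.

(** For fixed j and n the iterated difference is a function [F] of the base point, whose derivative
    is the iterated difference of the inverses, nonnegative by [cmono_inv]; hence [F a <= F b]. *)
Lemma cmono_ln a b h : 0 < a -> a <= b -> 0 <= h ->
  cmono (fun n => ln (b + n%:R * h) - ln (a + n%:R * h)).
Proof.
move=> a0 ab h0 j n.
pose F x := iter j nabla (fun n => ln (x + n%:R * h)) n.
have -> : iter j nabla (fun n => ln (b + n%:R * h) - ln (a + n%:R * h)) n =
    F b - F a.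
  rewrite /F -[- iter _ _ _ _]mulN1r -nabla_iterZ -nabla_iterD.
  by apply: eq_nabla_iter => i; rewrite mulN1r.
have dF x : 0 < x -> is_derive x 1 F (iter j nabla (fun n => (x + n%:R * h)^-1) n).
  move=> x0; rewrite /F; elim: j n {F} => [|j IH] n /=.
    have xn0 : 0 < x + n%:R * h by rewrite ltr_wpDr// mulr_ge0.
    have dg : is_derive x (1 : R) (fun y => y + n%:R * h) (1 + 0).
      exact: is_deriveD.
    have dl : is_derive ((fun y => y + n%:R * h) x) 1 (@ln R) (x + n%:R * h)^-1.
      exact: is_derive1_ln.
    by have := @is_derive1_comp R (@ln R) (fun y => y + n%:R * h) x _ _ dl dg; rewrite addr0 mulr1.
  by apply: is_deriveB.
have dF1 x : 0 < x -> derive1 F x = iter j nabla (fun n => (x + n%:R * h)^-1) n.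
  by move=> x0; rewrite derive1E; exact/derive_val/dF.
rewrite subr_ge0; apply: (@ger0_derive1_le_cc _ F a b) => //.
- by move=> x; rewrite in_itv/= => /andP[/(lt_trans a0) x0 _]; have [] := dF x x0.
- move=> x; rewrite in_itv/= => /andP[/(lt_trans a0) x0 _]; rewrite dF1//.
  exact: cmono_inv.
- apply: continuous_in_subspaceT => x; rewrite inE/= in_itv/= => /andP[ax _].
  have [dFx _] := dF x (lt_le_trans a0 ax).
  exact/differentiable_continuous/derivable1_diffP.
- by rewrite in_itv/= lexx.
- by rewrite in_itv/= lexx andbT.
Qed.

Lemma cmono_powR_ratio a b c h : 0 < a -> a <= b -> 0 <= h -> 0 <= c ->
  cmono (fun n => ((b + n%:R * h) / (a + n%:R * h)) `^ c).
Proof.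
move=> a0 ab h0 c0.
have p x n : 0 < x -> 0 < x + n%:R * h by move=> x0; rewrite ltr_wpDr// mulr_ge0.
have b0 := lt_le_trans a0 ab.
have -> : (fun n => ((b + n%:R * h) / (a + n%:R * h)) `^ c) =
    fun n => expR (c * (ln (b + n%:R * h) - ln (a + n%:R * h))).
  apply/funext => n; rewrite /powR gt_eqF ?divr_gt0 ?p//.
  by rewrite ln_div// posrE p.
by apply: cmono_expR; apply: cmonoZ => //; exact: cmono_ln.
Qed.

End completely_monotone.

(** * Hausdorff's moment theorem *)

Section bernstein.
Variable R : realType.
Implicit Types (u : nat -> R) (g h : nat -> R).

(* [bern N u g] is the sum of [L('C(N, i) X^i (1 - X)^(N - i)) * g i] over
   [i <= N], where [L] is the linear form on polynomials with [L('X^n) = u n];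
   the recursion splits [L p] as [L((1 - X) p) + L(X p)]. *)
Fixpoint bern N u g : R :=
  if N is N'.+1 then bern N' (nabla u) g + bern N' (shift u) (g \o S)
  else u 0%N * g 0%N.

Lemma bernD N u g h :
  bern N u (fun i => g i + h i) = bern N u g + bern N u h.
Proof.
elim: N u g h => [|N IH] u g h /=; first by rewrite mulrDr.
rewrite IH (_ : (fun i => g i + h i) \o S = fun i => (g \o S) i + (h \o S) i)//.
by rewrite IH addrACA.
Qed.

Lemma bernZ N u c g : bern N u (fun i => c * g i) = c * bern N u g.
Proof.
elim: N u g => [|N IH] u g /=; first by rewrite mulrCA.
rewrite IH (_ : (fun i => c * g i) \o S = fun i => c * (g \o S) i)//.
by rewrite IH mulrDr.
Qed.

Lemma bernB N u g h :
  bern N u (fun i => g i - h i) = bern N u g - bern N u h.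
Proof.
rewrite -[- bern N u h]mulN1r -bernZ -bernD; congr bern.
by apply/funext => i; rewrite mulN1r.
Qed.

Lemma bern_cst N u c : bern N u (fun=> c) = u 0%N * c.
Proof.
elim: N u => // N IH u /=.
by rewrite (_ : (fun=> c) \o S = fun=> c)// !IH /nabla /shift; ring.
Qed.

Lemma bern_sum (I : Type) (r : seq I) N u (f : I -> nat -> R) :
  bern N u (fun i => \sum_(j <- r) f j i) = \sum_(j <- r) bern N u (f j).
Proof.
elim: r => [|j r IH].
  by under eq_fun do rewrite big_nil; rewrite big_nil bern_cst mulr0.
by under eq_fun do rewrite big_cons; rewrite bernD IH big_cons.
Qed.

Lemma bern_ge0 N u g : cmono u -> (forall i, (i <= N)%N -> 0 <= g i) ->
  0 <= bern N u g.
Proof.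
elim: N u g => [|N IH] u g cu g0 /=; first by rewrite mulr_ge0 ?g0 //; exact: cmono_ge0.
apply: addr_ge0; apply: IH.
- exact: cmono_nabla.
- by move=> i iN; apply: g0; exact: leqW.
- exact: cmono_shift.
- by move=> i iN; exact: g0.
Qed.

Lemma bern_le N u g h : cmono u -> (forall i, (i <= N)%N -> g i <= h i) ->
  bern N u g <= bern N u h.
Proof.
move=> cu gh; rewrite -subr_ge0 -bernB; apply: bern_ge0 => // i iN.
by rewrite subr_ge0 gh.
Qed.

Lemma eq_bern N u g h : (forall i, (i <= N)%N -> g i = h i) ->
  bern N u g = bern N u h.
Proof.
elim: N u g h => [|N IH] u g h gh /=; first by rewrite gh.
congr (_ + _); apply: IH => i iN; apply: gh => //.
exact: leqW.
Qed.

(** The absorption identity i 'C(N+1, i) = (N+1) 'C(N, i-1); the freed factor X becomes [shift]. *)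
Lemma bern_natl N u h :
  bern N.+1 u (fun i => i%:R * h i) = N.+1%:R * bern N (shift u) (h \o S).
Proof.
elim: N u h => [|N IH] u h; first by rewrite /= /shift; ring.
rewrite [LHS]/=.
rewrite -[bern N _ _ + _ in X in X + _]/(bern N.+1 (nabla u) (fun i => i%:R * h i)) IH.
rewrite -[bern N _ _ + _ in X in _ + X]/(bern N.+1 (shift u) ((fun i => i%:R * h i) \o S)).
have -> : (fun i => i%:R * h i) \o S =
    fun i => i%:R * (h \o S) i + (h \o S) i.
  by apply/funext => i /=; rewrite -natr1 mulrDl mul1r.
rewrite bernD IH /= -[N.+2%:R]natr1 nabla_shift; ring.
Qed.

Lemma exprB_le (a b : R) n : 0 <= a -> a <= b -> b <= 1 ->
  b ^+ n - a ^+ n <= n%:R * (b - a).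
Proof.
move=> a0 ab b1; elim: n => [|n IH]; first by rewrite !expr0 subrr mul0r.
have -> : b ^+ n.+1 - a ^+ n.+1 = b * (b ^+ n - a ^+ n) + (b - a) * a ^+ n.
  by rewrite !exprS; ring.
rewrite -[n.+1%:R]natr1 [X in _ <= X]mulrDl mul1r lerD//.
  rewrite (le_trans _ IH)// ler_piMl// subr_ge0 lerXn2r// nnegrE//.
  exact: le_trans ab.
by rewrite ler_piMr ?subr_ge0// exprn_ile1// (le_trans ab).
Qed.

(** Induction on n: [bern_natl] trades one power for a shift of [u], at the cost of the nodes (i+1)
    / (N+1) in place of i / N. The bound [lip] shows that this change vanishes in the limit. *)
Lemma bern_cvg_moment u n : cmono u ->
  bern N u (fun i => (i%:R / N%:R) ^+ n) @[N --> \oo] --> u n.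
Proof.
elim: n u => [|n IH] u cu.
  under eq_fun do under eq_fun do rewrite expr0.
  by under eq_fun do rewrite bern_cst mulr1; exact: cvg_cst.
have csu := cmono_shift cu.
rewrite -(cvg_shiftn 1)/=.
pose A N := bern N (shift u) (fun i => (i.+1%:R / N.+1%:R) ^+ n).
have -> : (fun N => bern (N + 1) u (fun i => (i%:R / (N + 1)%:R) ^+ n.+1)) = A.
  apply/funext => N; rewrite addn1.
  have -> : (fun i => (i%:R / N.+1%:R) ^+ n.+1) =
      fun i => i%:R * (N.+1%:R^-1 * (i%:R / N.+1%:R) ^+ n) :> R.
    by apply/funext => i; rewrite exprS mulrA.
  rewrite bern_natl (_ : _ \o S = fun i => N.+1%:R^-1 * (i.+1%:R / N.+1%:R) ^+ n)//.
  by rewrite bernZ mulrA divff ?mul1r// pnatr_eq0.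
pose B N := bern N (shift u) (fun i => (i%:R / N%:R) ^+ n).
have AB N : 0 <= A N - B N <= (n%:R * u 1%N) * N.+1%:R^-1.
  rewrite -bernB.
  have lip i : (i <= N)%N ->
      0 <= ((i.+1%:R / N.+1%:R) ^+ n - (i%:R / N%:R) ^+ n : R) <= n%:R * N.+1%:R^-1.
    move=> iN.
    have a0 : 0 <= i%:R / N%:R :> R by rewrite divr_ge0.
    have b1 : i.+1%:R / N.+1%:R <= 1 :> R by rewrite ler_pdivrMr// mul1r ler_nat.
    have dE : 0 <= (i.+1%:R / N.+1%:R - i%:R / N%:R : R) <= N.+1%:R^-1.
      (* For N = 0 only i = 0 remains, and the default 0 / 0 = 0 makes the upper bound an
         equality. *)
      case: N iN {a0 b1} => [|N] iN.
        by move: iN; rewrite leqn0 => /eqP ->; rewrite mul0r subr0 divr1 invr1 lexx ler01.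
      have -> : i.+1%:R / N.+2%:R - i%:R / N.+1%:R = (N.+1 - i)%:R / N.+1%:R / N.+2%:R :> R.
        rewrite natrB// -[N.+2%:R]natr1 -[i.+1%:R]natr1.
        by field; rewrite nat1r natr1 !pnatr_eq0.
      rewrite !divr_ge0//= ler_piMl ?invr_ge0// ler_pdivrMr// mul1r ler_nat.
      exact: leq_subr.
    move: dE => /andP[d1 d2]; rewrite subr_ge0 in d1.
    rewrite subr_ge0 lerXn2r ?nnegrE ?divr_ge0//=.
    by rewrite (le_trans (exprB_le _ _ _ _))// ler_wpM2l.
  apply/andP; split; first by apply: bern_ge0 => // i /lip /andP[].
  rewrite -mulrA [u _ * _]mulrC mulrA [X in _ <= X]mulrC -[u 1%N]/(shift u 0).
  rewrite -(bern_cst N); apply: bern_le => // i /lip /andP[_].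
  by [].
have -> : A = B \+ (A \- B) by apply/funext => N /=; rewrite addrC subrK.
rewrite -[u n.+1]addr0; apply: cvgD; first exact: IH.
apply: (@squeeze_cvgr _ _ _ _ (cst 0) (fun N => (n%:R * u 1%N) * N.+1%:R^-1)).
- by apply: nearW => N; exact: AB.
- exact: cvg_cst.
- rewrite -[X in _ --> X](mulr0 (n%:R * u 1%N)).
  by apply: cvgM; [exact: cvg_cst|exact: cvg_harmonic].
Qed.

End bernstein.

(** * Step moments, limits along ultrafilters and distribution functions *)

Section hausdorff.
Variable R : realType.
Implicit Types (u : nat -> R) (F : R -> R).

(* Abel summation of [x ^+ n] against a distribution function [F] on the grid
   [j / K]. *)
Definition step_moment K n F : R := 1 -
  \sum_(0 <= j < K) ((j.+1%:R / K%:R) ^+ n - (j%:R / K%:R) ^+ n) * F (j%:R / K%:R).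

(** The sum telescopes from the first node at or above [x], so the step moment is the n-th power of
    that node, within n / K of [x ^+ n]. The invariant [main] follows the partial sums. *)
Lemma step_moment_indic K n (x : R) : (0 < K)%N -> 0 <= x -> x <= 1 ->
  0 <= step_moment K n (fun y => (x <= y)%R%:R) - x ^+ n <= n%:R / K%:R.
Proof.
move=> K0 x0 x1.
have K0' : 0 < K%:R :> R by rewrite ltr0n.
pose g j : R := j%:R / K%:R.
have g0 j : 0 <= g j by rewrite divr_ge0.
have gS j : g j <= g j.+1 by rewrite ler_pM2r ?invr_gt0// ler_nat.
pose sg m := \sum_(0 <= j < m) (g j.+1 ^+ n - g j ^+ n) * (x <= g j)%R%:R.
suff main m : (m <= K)%N -> if x <= g m
    then 0 <= g m ^+ n - sg m - x ^+ n <= n%:R / K%:R else sg m == 0.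
  have gK : g K = 1 by rewrite /g divff// gt_eqF.
  have := main K (leqnn K); rewrite gK x1 expr1n.
  by rewrite /step_moment /sg.
elim: m => [_|m IH mK].
  rewrite /sg big_nil /g mul0r; case: ifPn => // x0'.
  have -> : x = 0 by apply/eqP; rewrite eq_le x0 x0'.
  by rewrite subr0 subrr lexx/= divr_ge0.
have {}IH := IH (ltnW mK).
have sgS : sg m.+1 = sg m + (g m.+1 ^+ n - g m ^+ n) * (x <= g m)%R%:R.
  by rewrite /sg big_nat_recr.
rewrite {}sgS; case: ifPn => [xm1|]; last first.
  rewrite -ltNge => /(le_lt_trans (gS m)); rewrite ltNge => /negbTE xm.
  by move: IH; rewrite xm => /eqP ->; rewrite mulr0 addr0.
move: IH; case: ifPn => [xm|xm] IH.
  rewrite mulr1 (_ : g m.+1 ^+ n - _ = g m ^+ n - sg m)//; ring.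
rewrite (eqP IH) mulr0 addr0 subr0 subr_ge0 lerXn2r ?nnegrE//=.
have gm1 : g m.+1 <= 1 by rewrite /g ler_pdivrMr// mul1r ler_nat.
rewrite (le_trans (exprB_le _ x0 xm1 gm1))// ler_wpM2l//.
have -> : K%:R^-1 = g m.+1 - g m by rewrite /g -mulrBl -natr1 addrAC subrr add0r mul1r.
by rewrite lerD2l lerN2; move: xm; rewrite -ltNge => /ltW.
Qed.

(** By compactness the ultrafilter clusters at a point of [0, 1], and an ultrafilter converges to
    each of its cluster points. *)
Lemma ultra_cvg_bounded (U : set_system nat) (a : nat -> R) : UltraFilter U ->
  (forall N, 0 <= a N <= 1) -> cvg (a N @[N --> U]).
Proof.
move=> UU a01; have := @segment_compact R 0 1.
move=> /(_ (a N @[N --> U]) _ _)[|p [_ clp]].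
  by apply: (@filterE _ U _ (fun N => `[0, 1]%classic (a N))) => N; rewrite /= in_itv/= a01.
apply/cvg_ex; exists p => V nV.
have [//|UnV] := in_ultra_setVsetC (a @^-1` V) UU.
by have [y [/= ? ?]] := clp (~` V) V UnV nV.
Qed.

(** The right limit F(x+). The pointwise limit of distribution functions obtained below need not be
    right-continuous, as a cumulative function must be. *)
Definition right_reg F (x : R) : R := inf [set F y | y in `]x, +oo[].

Section right_regularization.
Variable F : R -> R.
Hypothesis ndF : nondecreasing F.
Hypothesis F_lt0 : forall x, x < 0 -> F x = 0.
Hypothesis F_ge1 : forall x, 1 <= x -> F x = 1.

Let F_ge0 x : 0 <= F x.
Proof.
have [/F_lt0 ->//|x0] := ltP x 0.
by rewrite -(F_lt0 (_ : -1 < 0)) ?ndF ?ltrN10// (le_trans _ x0)// lerN10.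
Qed.

Let has_infF x : has_inf [set F y | y in `]x, +oo[].
Proof.
split; first by exists (F (x + 1)), (x + 1) => //; rewrite /= in_itv/= andbT ltrDl.
by exists 0 => _ [y _ <-].
Qed.

Lemma right_reg_ge x : F x <= right_reg F x.
Proof.
apply: lb_le_inf; first by have [] := has_infF x.
by move=> _ [y + <-]; rewrite /= in_itv/= andbT => xy; exact/ndF/ltW.
Qed.

Lemma right_reg_le x y : x < y -> right_reg F x <= F y.
Proof.
move=> xy; apply: ge_inf; first by have [] := has_infF x.
by exists y => //; rewrite /= in_itv/= andbT.
Qed.

Lemma right_reg_nondecreasing : nondecreasing (right_reg F).
Proof.
move=> x y xy; apply: lb_le_inf; first by have [] := has_infF y.
move=> _ [z + <-]; rewrite /= in_itv/= andbT => yz.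
by apply: right_reg_le; exact: le_lt_trans yz.
Qed.

Lemma right_reg_right_continuous : right_continuous (right_reg F).
Proof.
move=> x; apply/cvgrPdist_lt => e e0.
have [_ [y + <-] yle] := inf_adherent e0 (has_infF x).
rewrite /= in_itv/= andbT => xy.
near=> z.
have xz : x < z by near: z; exact: nbhs_right_gt.
have zy : z < y by near: z; exact: nbhs_right_lt.
rewrite distrC ger0_norm ?subr_ge0; last exact/right_reg_nondecreasing/ltW.
by rewrite ltrBlDl (le_lt_trans (right_reg_le zy)).
Unshelve. all: by end_near. Qed.

Lemma right_reg_lt0 x : x < 0 -> right_reg F x = 0.
Proof.
move=> x0; apply/eqP; rewrite eq_le; apply/andP; split.
  rewrite -(F_lt0 (_ : x / 2 < 0)); last by rewrite pmulr_llt0 ?invr_gt0.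
  by apply: right_reg_le; lra.
by rewrite (le_trans (F_ge0 x))// right_reg_ge.
Qed.

Lemma right_reg_ge1 x : 1 <= x -> right_reg F x = 1.
Proof.
move=> x1; apply/eqP; rewrite eq_le; apply/andP; split.
  rewrite -(F_ge1 (_ : 1 <= x + 1)); last by lra.
  by apply: right_reg_le; rewrite ltrDl.
by rewrite -(F_ge1 x1) right_reg_ge.
Qed.

Lemma cdf_measure_exists :
  exists P : {measure set (measurableTypeR R) -> \bar R},
    P setT = 1%E /\ forall x, P `]-oo, x]%classic = (right_reg F x)%:E.
Proof.
have cy : right_reg F x @[x --> +oo] --> (1 : R).
  apply: cvg_near_cst; apply: filterS (nbhs_pinfty_ge (num_real 1)) => x.
  exact: right_reg_ge1.
have cNy : right_reg F x @[x --> -oo] --> (0 : R).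
  apply: cvg_near_cst; apply: filterS (nbhs_ninfty_lt (num_real 0)) => x.
  exact: right_reg_lt0.
pose m1 := isCumulative.Build R _ R (right_reg F)
  right_reg_nondecreasing right_reg_right_continuous.
pose m2 := isCumulativeBounded.Build R 0 1 (right_reg F) cNy cy.
pose G : cumulativeBounded (0:R) (1:R) := HB.pack (right_reg F) m1 m2.
exists (lebesgue_stieltjes_measure G); split.
  exact: (@probability_setT _ _ _ (lebesgue_stieltjes_measure G)).
by move=> x; have := cdf_lebesgue_stieltjes_id G x.
Qed.

End right_regularization.

End hausdorff.

(** * Construction of the measure on [0, 1] from a completely monotone sequence *)

Section hausdorff_moment.
Variable R : realType.
Implicit Types (u : nat -> R) (F : R -> R).

Lemma Rintegral_sum d (T : measurableType d) (mu : {measure set T -> \bar R})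
    (D : set T) (I : Type) (r : seq I) (f : I -> T -> R) : measurable D ->
  (forall i, mu.-integrable D (EFin \o f i)) ->
  mu.-integrable D (EFin \o (fun x => \sum_(i <- r) f i x)) /\
  \int[mu]_(x in D) (\sum_(i <- r) f i x) = \sum_(i <- r) \int[mu]_(x in D) f i x.
Proof.
move=> mD fi; elim: r => [|i r [IHi IH]].
  under eq_fun do rewrite big_nil; split.
    exact: integrable0.
  by rewrite big_nil Rintegral_cst// mul0r.
under eq_fun do rewrite big_cons; split.
  by have := integrableD mD (fi i) IHi; apply: eq_integrable.
by rewrite big_cons RintegralD// IH.
Qed.

Lemma step_moment_cvg (T : Type) (U : set_system T) (f : T -> R -> R) F K n :
  ProperFilter U -> (forall x, f t x @[t --> U] --> F x) ->
  step_moment K n (f t) @[t --> U] --> step_moment K n F.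
Proof.
move=> UU fF; apply: cvgB; first exact: cvg_cst.
apply: cvg_big => [|j _]; first exact: add_continuous.
by apply: cvgM; [exact: cvg_cst|exact: fF].
Qed.

(** At a node, [right_reg F] lies between [F] there and [F] at the next node, so the difference is
    dominated by n / K times a telescoping sum of increments of [F]. *)
Lemma step_moment_right_reg F K n : nondecreasing F ->
  (forall x : R, x < 0 -> F x = 0) -> (forall x, 1 <= x -> F x = 1) -> (0 < K)%N ->
  0 <= step_moment K n F - step_moment K n (right_reg F) <= n%:R / K%:R.
Proof.
move=> ndF F0 F1 K0.
have K0' : 0 < K%:R :> R by rewrite ltr0n.
pose g j : R := j%:R / K%:R.
have g0 j : 0 <= g j by rewrite divr_ge0.
have gS j : g j < g j.+1 by rewrite ltr_pM2r ?invr_gt0// ltr_nat.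
have -> : step_moment K n F - step_moment K n (right_reg F) =
    \sum_(0 <= j < K) (g j.+1 ^+ n - g j ^+ n) * (right_reg F (g j) - F (g j)).
  under eq_bigr do rewrite mulrBr.
  by rewrite sumrB /step_moment opprD opprK addrACA subrr add0r addrC.
have c0 j : 0 <= g j.+1 ^+ n - g j ^+ n.
  by rewrite subr_ge0 lerXn2r ?nnegrE// ltW.
apply/andP; split.
  by apply: sumr_ge0 => j _; rewrite mulr_ge0// subr_ge0 right_reg_ge.
apply: (@le_trans _ _ (\sum_(0 <= j < K) n%:R / K%:R * (F (g j.+1) - F (g j)))).
  rewrite !big_seq; apply: ler_sum => j; rewrite mem_index_iota => /andP[_ jK].
  apply: ler_pM => //.
  - by rewrite subr_ge0 right_reg_ge.
  - have g1 : g j.+1 <= 1 by rewrite /g ler_pdivrMr// mul1r ler_nat.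
    rewrite (le_trans (exprB_le _ (g0 j) (ltW (gS j)) g1))// ler_wpM2l//.
    by rewrite /g -mulrBl -natr1 addrAC subrr add0r mul1r.
  - by rewrite lerD2r right_reg_le.
rewrite -mulr_sumr telescope_sumr// ler_piMr ?divr_ge0//.
have -> : g K = 1 by rewrite /g divff// gt_eqF.
rewrite (F1 1)// lerBlDr lerDl -(F0 (-1)) ?ltrN10//.
by apply: ndF; rewrite (le_trans (lerN10 R)).
Qed.

Lemma eq0_le_harmonic (d c : R) : (forall K, (0 < K)%N -> `|d| <= c / K%:R) -> d = 0.
Proof.
move=> dc; apply/eqP; rewrite -normr_le0.
have c0 : (c / n.+1%:R) @[n --> \oo] --> c * 0.
  by apply: cvgM; [exact: cvg_cst|exact: cvg_harmonic].
rewrite mulr0 in c0; rewrite -(cvg_lim _ c0)//.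
apply: limr_ge; first by apply/cvg_ex; exists 0.
by apply: nearW => n; exact: dc.
Qed.

(** Integrating [step_moment_indic] over [x] turns the indicator of [x <= y] into [F y] and keeps
    the bounds, since [P] has mass 1 on [0, 1]. *)
Lemma step_moment_integral (P : {measure set (measurableTypeR R) -> \bar R}) F n :
  P setT = 1%E -> P (~` `[0, 1]%classic) = 0%E ->
  (forall x, P `]-oo, x]%classic = (F x)%:E) ->
  forall K, (0 < K)%N ->
  P.-integrable `[0, 1]%classic (EFin \o (fun x => x ^+ n)) /\
  0 <= step_moment K n F - \int[P]_(x in `[0, 1]) (x ^+ n) <= n%:R / K%:R.
Proof.
move=> PT P0 PF K K0.
pose D : set (measurableTypeR R) := `[0, 1]%classic.
have mD : measurable D by exact: measurable_itv.
have PI (A : set (measurableTypeR R)) : measurable A -> P (A `&` D) = P A.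
  move=> mA; rewrite [RHS](measureDI _ mA mD) [X in _ = (X + _)%E](_ : _ = 0%E) ?add0e//.
  apply: measure_negligible; first exact: measurableD.
  apply: (@negligibleS _ _ _ _ (~` D)); first by move=> x [].
  by apply/negligibleP => //; exact: measurableC.
have PD : P D = 1%E by rewrite -[D]setTI PI.
have bi (h : R -> R) : measurable_fun D h -> (forall x, D x -> `|h x| <= 1) ->
    P.-integrable D (EFin \o h).
  move=> mh h1; apply: measurable_bounded_integrable => //; first by rewrite PD ltry.
  by exists 1; split => // M M1 x Dx; exact: le_trans (h1 x Dx) (ltW M1).
have xn1 x : D x -> 0 <= x <= 1 by rewrite /D/= in_itv.
have ixn : P.-integrable D (EFin \o (fun x => x ^+ n)).
  apply: bi; first by apply: measurable_funX; exact: measurable_id.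
  move=> x /xn1 /andP[x0 x1]; rewrite ger0_norm ?exprn_ge0//.
  by rewrite exprn_ile1.
have indE y : (fun x : R => (x <= y)%R%:R) = \1_(`]-oo, y]%classic) :> (R -> R).
  apply/funext => x; rewrite indicE; congr (_%:R); congr nat_of_bool.
  by apply/idP/idP; rewrite inE/= in_itv.
have iind y : P.-integrable D (EFin \o (fun x : R => (x <= y)%R%:R)).
  apply: bi; first by rewrite indE; exact: measurable_indic.
  by move=> x _; rewrite normr_nat lern1 leq_b1.
have Iind (y : R) : \int[P]_(x in D) (x <= y)%R%:R = F y.
  rewrite -[LHS]/(\int[P]_(x in D) (fun x : R => (x <= y)%R%:R) x) indE.
  rewrite /Rintegral integral_indic//.
  by rewrite PI ?PF//; exact: measurable_itv.
split => //.
pose g j : R := j%:R / K%:R.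
pose c j : R := g j.+1 ^+ n - g j ^+ n.
pose phi (x : R) := step_moment K n (fun y => (x <= y)%R%:R).
have isum := @Rintegral_sum _ _ P D _ (index_iota 0 K)
  (fun j x => c j * (x <= g j)%R%:R) mD.
have [j|isum1 isum2] := isum.
  by have := integrableZl mD (c j) (iind (g j)); apply: eq_integrable.
have i1 : P.-integrable D (EFin \o cst 1).
  by apply: bi => // x _; rewrite normr1.
have iphi : P.-integrable D (EFin \o phi).
  by have := integrableB mD i1 isum1; apply: eq_integrable.
have Iphi : \int[P]_(x in D) phi x = step_moment K n F.
  rewrite /phi /step_moment RintegralB// Rintegral_cst// PD mulr1 isum2.
  congr (_ - _); apply: eq_bigr => j _.
  by rewrite RintegralZl// Iind.
rewrite -Iphi -RintegralB//; apply/andP; split.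
  apply: Rintegral_ge0 => x /xn1 /andP[x0 x1].
  by have /andP[] := step_moment_indic n K0 x0 x1.
have -> : n%:R / K%:R = \int[P]_(x in D) (n%:R / K%:R).
  by rewrite Rintegral_cst// PD mulr1.
apply: le_Rintegral => //.
- by have := integrableB mD iphi ixn; apply: eq_integrable.
- have := integrableZl mD (n%:R / K%:R) i1; apply: eq_integrable => // x _.
  by rewrite /= mule1.
- move=> x /xn1 /andP[x0 x1].
  by have /andP[] := step_moment_indic n K0 x0 x1.
Qed.

(** Here [bern N u] acts as a discrete probability measure on the nodes i / N, with distribution
    function [f N]. The limit [F] of these has step moments within n / K of [u n]; its right
    regularization defines [P], and K tends to infinity. *)
Theorem hausdorff_moment u : cmono u -> u 0%N = 1 ->
  exists P : {measure set (measurableTypeR R) -> \bar R},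
    P (~` `[0, 1]%classic) = 0%E /\
    forall n, (\int[P]_(x in `[0%R, 1%R]) (x ^+ n)%:E = (u n)%:E)%E.
Proof.
move=> cu u0.
(* Limits along an ultrafilter replace Helly's selection theorem. *)
have [U [UU oU]] := ultraFilterLemma (_ : ProperFilter \oo).
have bc N c : bern N u (fun=> c) = c by rewrite bern_cst u0 mul1r.
pose f N (x : R) := bern N u (fun i => (i%:R / N%:R <= x)%R%:R).
have f01 x N : 0 <= f N x <= 1.
  rewrite bern_ge0//= -[leRHS](bc N).
  by apply: bern_le => // i _; rewrite lern1 leq_b1.
pose F x := lim (f N x @[N --> U]).
have fF x : f N x @[N --> U] --> F x by exact: ultra_cvg_bounded.
have ndF : nondecreasing F.
  move=> x y xy; apply: (ler_cvg_to (fF x) (fF y)); apply: nearW => N.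
  apply: bern_le => // i _; rewrite ler_nat.
  by case: (leP _ x) => //= /le_trans ->.
have F0 (x : R) : x < 0 -> F x = 0.
  move=> x0; apply: cvg_lim => //; apply: cvg_near_cst; apply: nearW => N.
  rewrite /f -[RHS](bc N); apply: eq_bern => i _.
  by rewrite leNgt (lt_le_trans x0)// divr_ge0.
have F1 (x : R) : 1 <= x -> F x = 1.
  move=> x1; apply: cvg_lim => //; apply: cvg_near_cst; apply: nearW => N.
  rewrite /f -[RHS](bc N); apply: eq_bern => i iN.
  rewrite (le_trans _ x1)//; case: N iN => [|N] iN; first by rewrite invr0 mulr0.
  by rewrite ler_pdivrMr// mul1r ler_nat.
have FE n K : (0 < K)%N -> 0 <= step_moment K n F - u n <= n%:R / K%:R.
  move=> K0.
  have cB : step_moment K n (f N) - bern N u (fun i => (i%:R / N%:R) ^+ n)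
      @[N --> U] --> step_moment K n F - u n.
    apply: cvgB; first exact: step_moment_cvg.
    by move=> A /(@bern_cvg_moment _ u n cu) /oU.
  have B01 N : 0 <= step_moment K n (f N) - bern N u (fun i => (i%:R / N%:R) ^+ n)
      <= n%:R / K%:R.
    have -> : step_moment K n (f N) =
        bern N u (fun i => step_moment K n (fun y => (i%:R / N%:R <= y)%R%:R)).
      rewrite /step_moment bernB bern_cst u0 mulr1 bern_sum; congr (_ - _).
      by apply: eq_bigr => j _; rewrite bernZ.
    rewrite -bernB -[n%:R / K%:R](bc N).
    have st i : (i <= N)%N -> 0 <= step_moment K n
        (fun y => (i%:R / N%:R <= y)%R%:R) - (i%:R / N%:R : R) ^+ n <= n%:R / K%:R.
      move=> iN; apply: step_moment_indic; rewrite ?divr_ge0//.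
      case: N iN {cB} => [|N] iN; first by rewrite invr0 mulr0.
      by rewrite ler_pdivrMr// mul1r ler_nat.
    rewrite bern_ge0//=; last by move=> i /st /andP[].
    by apply: bern_le => // i /st /andP[].
  apply/andP; split.
    apply: (ler_cvg_to (cvg_cst 0) cB); apply: nearW => N; by have /andP[] := B01 N.
  by apply: (ler_cvg_to cB (cvg_cst _)); apply: nearW => N; have /andP[] := B01 N.
have [P [PT PF]] := cdf_measure_exists ndF F0 F1.
have P0 : P (~` `[0, 1]%classic) = 0%E.
  (* The left half-lines stop short of 0, where [P] may have an atom; on each of them the
     distribution function vanishes. *)
  have -> : ~` `[0, 1]%classic = \bigcup_k `]-oo, (- k.+1%:R^-1)%R]%classic `|` `]1, +oo[%classic :> set R.
    apply/seteqP; split => x /=; rewrite !in_itv/=.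
      move=> /negP; rewrite negb_and -!ltNge => /orP[x0|x1]; last by right; rewrite andbT.
      left; have [k xk] := ltr_add_invr x0.
      by exists k => //=; rewrite in_itv/= lerNr -[leRHS]add0r lerBrDl ltW.
    move=> [[k _]|]; last by rewrite andbT => x1 /andP[_]; rewrite leNgt x1.
    rewrite /= in_itv/= => xk /andP[x0 _]; have := le_trans x0 xk.
    by rewrite oppr_ge0 leNgt invr_gt0 ltr0n.
  apply: measure_negligible.
    apply: measurableU; last exact: measurable_itv.
    by apply: bigcupT_measurable => k; exact: measurable_itv.
  apply: negligibleU.
    apply: negligible_bigcup => k; apply/negligibleP; first exact: measurable_itv.
    transitivity (right_reg F (- k.+1%:R^-1))%:E; first exact: PF.
    by rewrite right_reg_lt0// oppr_lt0 invr_gt0.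
  apply/negligibleP; first exact: measurable_itv.
  set p := (X in X = _); have : P setT = (P `]-oo, 1%R]%classic + p)%E.
    rewrite /p.
    rewrite -measureU; try exact: measurable_itv.
      by congr (P _); apply/seteqP; split => x //= _; rewrite !in_itv/= andbT; case: leP; [left|right].
    apply/seteqP; split => x //= []; rewrite !in_itv/= andbT => x1.
    by rewrite ltNge x1.
  rewrite PT PF right_reg_ge1//; case: p => [r| |]//=.
  by rewrite -EFinD => -[r1]; congr EFin; lra.
exists P; split => // n.
have PE := @step_moment_integral P _ n PT P0 PF.
have [ixn _] := PE 1%N isT.
suff /eqP : u n - \int[P]_(x in `[0, 1]) (x ^+ n) = 0.
  rewrite subr_eq0 => /eqP ->; rewrite /Rintegral fineK//.
  by apply: integrable_fin_num => //; exact: measurable_itv.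
(* Three errors, each in [0, n / K]; the one between [u n] and the step moment of [F] enters with
   the opposite sign, so the total lies in [- n / K, 2 n / K]. *)
apply: (@eq0_le_harmonic _ (2 * n%:R)) => K K0.
have [_ ] := PE K K0; have := FE n K K0; have := step_moment_right_reg n ndF F0 F1 K0.
set a := step_moment _ _ _; set b := step_moment _ _ _; set c := Rintegral _ _ _.
rewrite -mulrA; set e := n%:R / _; rewrite ler_norml; lra.
Qed.

End hausdorff_moment.

(** * The Gamma function on [1, +oo[ *)

Section gamma.
Variable R : realType.
Implicit Types (a x s t : R).
Local Notation leb := (@lebesgue_measure R).

(** Half the decay of [expR (- t)] will be spent on absorbing the power; the other half stays
    integrable. *)
Lemma powR_le_expR a : 0 <= a ->
  exists2 C : R, 0 < C & forall t, 0 <= t -> t `^ a <= C * expR (t / 2).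
Proof.
move=> a0; have [n an] : exists n, a <= n.+1%:R.
  by exists (Num.bound a); rewrite ltW// (lt_trans (archi_boundP a0))// ltr_nat.
(* The summand 1 serves t < 1; the other one comes from the Taylor term of order n + 1 of
   [expR (t / 2)] and serves t >= 1. *)
exists (1 + 2 ^+ n.+1 * n.+1`!%:R).
  by rewrite ltr_pwDl// mulr_ge0 ?exprn_ge0.
move=> t t0.
have e1 : 1 <= expR (t / 2) by rewrite -expR0 ler_expR divr_ge0.
have tn : t ^+ n.+1 <= 2 ^+ n.+1 * n.+1`!%:R * expR (t / 2).
  have t2 : 0 <= t / 2 by rewrite divr_ge0.
  have := expR_ge1Dxn n t2; rewrite expr_div_n => h.
  have {}h : t ^+ n.+1 / 2 ^+ n.+1 / n.+1`!%:R <= expR (t / 2).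
    by rewrite (le_trans _ h)// lerDr.
  rewrite [leRHS]mulrC -ler_pdivrMr ?mulr_gt0 ?exprn_gt0 ?ltr0n ?fact_gt0//.
  by rewrite invfM mulrA.
rewrite mulrDl mul1r; have [t1|t1] := leP 1 t.
  apply: (le_trans (ler_powR t1 an)); rewrite powR_mulrn// (le_trans tn)//.
  by rewrite lerDr expR_ge0.
apply: (@le_trans _ _ 1); last first.
  by rewrite (le_trans e1)// lerDl !mulr_ge0 ?exprn_ge0 ?expR_ge0.
have [->|t0'] := eqVneq t 0; first by rewrite /powR eqxx; case: eqP.
have tp : 0 < t by rewrite lt_def t0' t0.
rewrite -(powRr0 t); apply: ger_powR => //.
by rewrite tp ltW.
Qed.

Lemma cvg_expRN2 : expR (- (t / 2)) @[t --> +oo] --> (0 : R).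
Proof.
have h : t / 2 @[t --> +oo] --> (+oo : set_system R).
  apply/cvgryPge => A; apply: filterS (nbhs_pinfty_ge (num_real (A * 2))) => t.
  by rewrite ler_pdivlMr.
have := @cvg_comp _ _ _ (fun t : R => t / 2) (fun t : R => expR (- t)) _ _ _ h (@cvgr_expR R).
exact.
Qed.

Lemma within_continuous_powR a : 0 <= a ->
  {within `[0, +oo[, continuous (fun t : R => t `^ a)}.
Proof.
rewrite le_eqVlt => /predU1P[<-|a0].
  have -> : (fun t : R => t `^ 0) = cst 1 by apply/funext => t; rewrite powRr0.
  by move=> t; exact: cvg_cst.
apply/continuous_within_itvcyP; split.
  move=> t; rewrite in_itv/= andbT => t0.
  apply/differentiable_continuous/derivable1_diffP.
  by apply: derivable_powR; rewrite in_itv/= t0.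
by rewrite powR0 ?gt_eqF//; exact: powR_cvg0.
Qed.

Let continuous_expRN : continuous (fun t : R => expR (- t)).
Proof.
move=> t; apply: continuous_comp; first exact: opp_continuous.
exact: continuous_expR.
Qed.

Let continuous_expRN2 : continuous (fun t : R => expR (- (t / 2))).
Proof.
move=> t; apply: (@continuous_comp _ _ _ (fun t : R => t / 2) (fun t => expR (- t))).
  exact: mulrr_continuous.
exact: continuous_expRN.
Qed.

Lemma integral_expRN (r : R) : 0 < r ->
  (\int[leb]_(t in `[0%R, +oo[) (r * expR (- r * t))%:E = 1)%E.
Proof.
move=> r0; rewrite -(integral_exponential_pdf r0) integral_mkcond.
by apply: eq_integral => t _; rewrite /exponential_pdf restrict_EFin.
Qed.

Lemma integrable_expRN (r : R) : 0 < r ->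
  leb.-integrable `[0, +oo[ (EFin \o (fun t => r * expR (- r * t))).
Proof.
move=> r0; apply/integrableP; split.
  apply/measurable_EFinP; apply: measurable_funTS; apply: continuous_measurable_fun.
  move=> t; apply: cvgM; first exact: cvg_cst.
  apply: (@continuous_comp _ _ _ (fun t : R => - r * t) expR).
    exact: mulrl_continuous.
  exact: continuous_expR.
under eq_integral do rewrite gee0_abs ?lee_fin ?mulr_ge0 ?expR_ge0 ?(ltW r0)//.
by rewrite integral_expRN// ltry.
Qed.

Lemma Rintegral_expRN2 : \int[leb]_(t in `[0, +oo[) expR (- (t / 2)) = 2.
Proof.
have h2 : 0 < 2^-1 :> R by rewrite invr_gt0.
have E t : expR (- (t / 2)) = 2 * (2^-1 * expR (- 2^-1 * t)).
  by rewrite mulrA divff// mul1r mulNr [t / 2]mulrC.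
under eq_Rintegral do rewrite E.
rewrite RintegralZl//; last exact: integrable_expRN.
by rewrite /Rintegral integral_expRN//= mulr1.
Qed.

Lemma integrable_expRN2 :
  leb.-integrable `[0, +oo[ (EFin \o (fun t => expR (- (t / 2)))).
Proof.
have h2 : 0 < 2^-1 :> R by rewrite invr_gt0.
have mI : measurable (`[0, +oo[%classic : set (measurableTypeR R)) by exact: measurable_itv.
have := integrableZl mI 2 (integrable_expRN h2); apply: eq_integrable => // t _ /=.
by rewrite -EFinM mulrA divff// mul1r mulNr [t / 2]mulrC.
Qed.

(** Gamma is only evaluated at x >= 1 below, where this integrand is continuous up to the endpoint
    0. *)
Definition gamma_integrand x t : R := t `^ (x - 1) * expR (- t).

Lemma gamma_integrand_continuous x : 1 <= x ->
  {within `[0, +oo[, continuous (gamma_integrand x)}.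
Proof.
move=> x1 t; apply: cvgM; first by apply: within_continuous_powR; rewrite subr_ge0.
exact/continuous_subspaceT/continuous_expRN.
Qed.

Lemma gamma_integrand_le x : 1 <= x -> exists2 C : R, 0 < C &
  forall t, 0 <= t -> 0 <= gamma_integrand x t <= C * expR (- (t / 2)).
Proof.
move=> x1; have [|C C0 h] := @powR_le_expR (x - 1); first by rewrite subr_ge0.
exists C => // t t0; rewrite /gamma_integrand mulr_ge0 ?powR_ge0 ?expR_ge0//=.
have -> : C * expR (- (t / 2)) = C * expR (t / 2) * expR (- t).
  by rewrite -mulrA -expRD; congr (_ * expR _); lra.
by rewrite ler_wpM2r ?expR_ge0// h.
Qed.

Lemma gamma_integrable x : 1 <= x ->
  leb.-integrable `[0, +oo[ (EFin \o gamma_integrand x).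
Proof.
move=> x1; have [C C0 h] := gamma_integrand_le x1.
have mI : measurable (`[0, +oo[%classic : set (measurableTypeR R)) by exact: measurable_itv.
apply: (le_integrable mI _ _ (integrableZl mI C integrable_expRN2)).
  apply/measurable_EFinP; apply: subspace_continuous_measurable_fun => //.
  exact: gamma_integrand_continuous.
move=> t; rewrite /= in_itv/= andbT => /h /andP[h1 h2].
by rewrite lee_fin !ger0_norm ?mulr_ge0 ?expR_ge0 ?powR_ge0 ?(ltW C0).
Qed.

Lemma GammaE x : 1 <= x ->
  Gamma x = \int[leb]_(t in `[0, +oo[) gamma_integrand x t.
Proof.
move=> x1; rewrite -Rintegral_itv_obnd_cbnd//.
apply: integrableS (gamma_integrable x1) => //.
by move=> t /=; rewrite !in_itv/= !andbT => /ltW.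
Qed.

Lemma Gamma1 : Gamma 1 = 1 :> R.
Proof.
rewrite GammaE// /Rintegral.
under eq_integral do rewrite /gamma_integrand subrr powRr0 mul1r -[X in expR X]mulN1r -[expR _]mul1r.
by rewrite integral_expRN.
Qed.

(** Integration by parts with the primitive - t^x e^(-t). The auxiliary term contributes 2 x C both
    to the integral of [f] and to [- F 0], so it cancels. *)
Lemma GammaS x : 1 <= x -> Gamma (x + 1) = x * Gamma x.
Proof.
move=> x1; have x0 : 0 < x by exact: lt_le_trans x1.
have x11 : 1 <= x + 1 by rewrite lerDr ltW.
have [C C0 hC] := gamma_integrand_le x1.
have [C' C'0 hC'] := gamma_integrand_le x11.
(* The multiple of [expR (- (t / 2))] makes the integrand nonnegative, as the
   improper fundamental theorem of calculus requires. *)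
pose f t := gamma_integrand (x + 1) t - x * gamma_integrand x t
  + x * C * expR (- (t / 2)).
pose F t := - (t `^ x * expR (- t)) - 2 * (x * C) * expR (- (t / 2)).
have mI : measurable (`[0, +oo[%classic : set (measurableTypeR R)) by exact: measurable_itv.
have i1 := gamma_integrable x1; have i2 := gamma_integrable x11.
have i3 : leb.-integrable `[0, +oo[ (EFin \o (fun t => x * gamma_integrand x t)).
  by have := integrableZl mI x i1; apply: eq_integrable.
have i4 : leb.-integrable `[0, +oo[ (EFin \o (fun t => x * C * expR (- (t / 2)))).
  by have := integrableZl mI (x * C) integrable_expRN2; apply: eq_integrable.
have i5 : leb.-integrable `[0, +oo[
    (EFin \o (fun t => gamma_integrand (x + 1) t - x * gamma_integrand x t)).
  by have := integrableB mI i2 i3; apply: eq_integrable.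
have If : \int[leb]_(t in `[0, +oo[) f t = Gamma (x + 1) - x * Gamma x + x * C * 2.
  rewrite !GammaE// RintegralD// RintegralB//.
  by rewrite !RintegralZl ?Rintegral_expRN2//; exact: integrable_expRN2.
have f0 t : 0 <= t -> 0 <= f t.
  move=> t0; have /andP[_ h1] := hC t t0; have /andP[h2 _] := hC' t t0.
  have h3 := ler_wpM2l (ltW x0) h1; rewrite [leRHS]mulrA in h3.
  by rewrite /f -addrA addr_ge0// addrC subr_ge0.
have dF t : 0 < t -> is_derive t 1 F (f t).
  move=> t0; have dP := is_derive1_powR x t0.
  have dE (r : R) : is_derive t 1 (fun t => expR (- (t * r))) (- r * expR (- (t * r))).
    have dl : is_derive t (1 : R) (fun t => - (t * r)) (- r).
      have := is_deriveZ (- r) (is_derive_id t (1 : R)).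
      rewrite (_ : (- r \*: id) = fun t : R => - (t * r)); last first.
        by apply/funext => y /=; rewrite scaleNr mulrC.
      by move/is_derive_eq; apply; rewrite /GRing.scale/= mulr1.
    have := @is_derive1_comp R expR (fun t => - (t * r)) t _ _ (is_derive_expR _) dl.
    by move/is_derive_eq; apply; rewrite mulrC.
  have dE1 := dE 1; have dE2 := dE 2^-1.
  rewrite (_ : (fun t => expR (- (t * 1))) = fun t => expR (- t)) in dE1; last first.
    by apply/funext => y; rewrite mulr1.
  have := is_deriveB (is_deriveN (is_deriveM dP dE1)) (is_deriveZ (2 * (x * C)) dE2).
  move/is_derive_eq; apply; rewrite /f /gamma_integrand addrK mulr1 /GRing.scale/=.
  by field.
have : \int[leb]_(t in `[0, +oo[) f t = 0 - F 0.
  apply: Rintegral_ge0_continuous_FTC2y => //.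
  - move=> t; apply: cvgD; first apply: cvgB.
    + exact: gamma_integrand_continuous.
    + apply: cvgM; first exact: cvg_cst.
      exact: gamma_integrand_continuous.
    + apply: cvgM; first exact: cvg_cst.
      exact/continuous_subspaceT/continuous_expRN2.
  - rewrite -[X in _ --> X](_ : - (0 : R) - 2 * (x * C) * 0 = 0); last by rewrite mulr0 subr0 oppr0.
    apply: cvgB; last first.
      by apply: cvgM; [exact: cvg_cst|exact: cvg_expRN2].
    apply: cvgN.
    apply: (@squeeze_cvgr _ _ _ _ (cst 0) (fun t => C' * expR (- (t / 2)))).
    + apply: filterS (nbhs_pinfty_ge (num_real 0)) => t /hC'.
      by rewrite /gamma_integrand addrK.
    + exact: cvg_cst.
    + rewrite -(mulr0 C'); apply: cvgM; [exact: cvg_cst|exact: cvg_expRN2].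
  - by move=> t /dF [].
  - rewrite /F; apply: cvgB; last first.
      apply: cvg_at_right_filter; apply: cvgM; first exact: cvg_cst.
      exact: continuous_expRN2.
    apply: cvgN; apply: cvgM.
      by rewrite powR0 ?gt_eqF//; exact: powR_cvg0.
    by apply: cvg_at_right_filter; exact: continuous_expRN.
  - move=> t; rewrite in_itv/= andbT => /dF dFt.
    by rewrite derive1E; exact: derive_val.
rewrite If /F mul0r oppr0 expR0 powR0 ?gt_eqF// mul0r; lra.
Qed.

End gamma.

(** * Asymptotics of Gamma (x + s) / Gamma x for large x *)

Section gamma_ratio.
Variable R : realType.
Implicit Types (a x s t : R).
Local Notation leb := (@lebesgue_measure R).

(** Concavity: the right side is the tangent at [x]. With y = t / x and L = ln y, the bounds 1 + v
    <= e^v at v = - s L and v = (1 - s) L are averaged with weights 1 - s and s, which cancels L. *)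
Lemma powR_le_tangent x s t : 0 < x -> 0 <= s <= 1 -> 0 <= t ->
  t `^ s <= x `^ s * (1 - s + s * (t / x)).
Proof.
move=> x0 /andP[s0 s1]; rewrite le_eqVlt => /predU1P[<-|t0].
  rewrite mul0r mulr0 addr0; have [->|sN0] := eqVneq s 0.
    by rewrite !powRr0 subr0 mulr1.
  by rewrite powR0// mulr_ge0 ?powR_ge0// subr_ge0.
pose y := t / x; have y0 : 0 < y by rewrite divr_gt0.
have -> : t `^ s = x `^ s * y `^ s.
  by rewrite -powRM ?(ltW x0) ?(ltW y0)// mulrC /y divfK// gt_eqF.
rewrite ler_wpM2l ?powR_ge0// -/y /powR gt_eqF//; set L := ln y.
have yE : y = expR (s * L) * expR ((1 - s) * L).
  by rewrite -expRD -mulrDl addrCA subrr addr0 mul1r lnK.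
have h1 : expR (s * L) * (1 - s * L) <= 1.
  rewrite -[leRHS](expRxMexpNx_1 (s * L)) ler_wpM2l ?expR_ge0//.
  exact: expR_ge1Dx.
have h2 : expR (s * L) * (1 + (1 - s) * L) <= y.
  by rewrite [leRHS]yE ler_wpM2l ?expR_ge0// expR_ge1Dx.
set E := expR (s * L) in h1 h2 *.
have -> : E = (1 - s) * (E * (1 - s * L)) + s * (E * (1 + (1 - s) * L)) by ring.
by rewrite lerD ?ler_wpM2l// -[leRHS]mulr1 ler_wpM2l// subr_ge0.
Qed.

(** The tangent bound for t^s, integrated against [gamma_integrand x]: the linear term yields Gamma
    (x + 1) = x Gamma x, and the weights 1 - s and s add up to 1. *)
Lemma Gamma_le x s : 1 <= x -> 0 <= s <= 1 -> Gamma (x + s) <= x `^ s * Gamma x.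
Proof.
move=> x1 /andP[]; rewrite le_eqVlt => /predU1P[<- _|s0 s1].
  by rewrite addr0 powRr0 mul1r.
have x0 : 0 < x by exact: lt_le_trans x1.
have x11 : 1 <= x + 1 by rewrite lerDr ltW.
have xs1 : 1 <= x + s by rewrite (le_trans x1)// lerDl ltW.
have mI : measurable (`[0, +oo[%classic : set (measurableTypeR R)) by exact: measurable_itv.
have i1 := gamma_integrable x1; have i2 := gamma_integrable x11.
pose c1 := x `^ s * (1 - s); pose c2 := x `^ s * (s / x).
have i3 : leb.-integrable `[0, +oo[ (EFin \o (fun t => c1 * gamma_integrand x t)).
  by have := integrableZl mI c1 i1; apply: eq_integrable.
have i4 : leb.-integrable `[0, +oo[ (EFin \o (fun t => c2 * gamma_integrand (x + 1) t)).
  by have := integrableZl mI c2 i2; apply: eq_integrable.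
have -> : x `^ s * Gamma x = \int[leb]_(t in `[0, +oo[)
    (c1 * gamma_integrand x t + c2 * gamma_integrand (x + 1) t).
  rewrite RintegralD// !RintegralZl// -!GammaE// GammaS// /c1 /c2.
  by field; rewrite gt_eqF.
rewrite GammaE//; apply: le_Rintegral => //.
- exact: gamma_integrable.
- by have := integrableD mI i3 i4; apply: eq_integrable.
move=> t; rewrite /= in_itv/= andbT => t0.
have E1 : gamma_integrand (x + 1) t = t * gamma_integrand x t.
  rewrite /gamma_integrand mulrA; congr (_ * _); rewrite [x + 1]addrC -addrA (@powRD _ t 1) ?powRr1//.
  by rewrite subrKC gt_eqF.
have E2 : gamma_integrand (x + s) t = t `^ s * gamma_integrand x t.
  rewrite /gamma_integrand mulrA; congr (_ * _); rewrite [x + s]addrC -addrA (@powRD _ t s)//.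
  by rewrite gt_eqF// ltr_pwDl// subr_ge0.
have g0 : 0 <= gamma_integrand x t by rewrite mulr_ge0 ?powR_ge0 ?expR_ge0.
rewrite E1 E2 mulrA -mulrDl ler_wpM2r//.
apply: (le_trans (powR_le_tangent x0 _ t0)); first by rewrite ltW.
by rewrite /c1 /c2 mulrDr -!mulrA [x^-1 * t]mulrC.
Qed.

Lemma Gamma_nat n : Gamma n.+1%:R = n`!%:R :> R.
Proof.
elim: n => [|n IH]; first by rewrite Gamma1.
by rewrite -natr1 GammaS ?ler1n// IH factS natrM.
Qed.

(** For n <= x < n + 1, [Gamma_le] bounds the positive value n! by a positive multiple of
    [Gamma x]. *)
Lemma Gamma_gt0 x : 1 <= x -> 0 < Gamma x.
Proof.
move=> x1; have x0 : 0 < x by exact: lt_le_trans x1.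
have [n /andP[nx xn]] : exists n : nat, n%:R <= x < n.+1%:R.
  by eexists; exact: truncn_itv (ltW x0).
have h : Gamma n.+1%:R <= x `^ (n.+1%:R - x) * Gamma x.
  rewrite -[n.+1%:R in X in X <= _](subrKC x); apply: Gamma_le => //.
  by rewrite subr_ge0 ltW//= lerBlDl -natr1 lerD2r.
have := lt_le_trans (_ : 0 < Gamma n.+1%:R) h.
rewrite Gamma_nat ltr0n fact_gt0 pmulr_rgt0 ?powR_gt0//.
exact.
Qed.

Definition gamma_ratio s x := Gamma (x + s) / (Gamma x * x `^ s).

(** The upper bound is [Gamma_le] from x to x + s, the lower one [Gamma_le] from x + s to x + 1
    together with x^s <= (x + s)^s. *)
Lemma gamma_ratio_bounds x s : 1 <= x -> 0 <= s <= 1 ->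
  x / (x + s) <= gamma_ratio s x <= 1.
Proof.
move=> x1 s01; have x0 : 0 < x by exact: lt_le_trans x1.
move: (s01) => /andP[s0 s1].
have xs1 : 1 <= x + s by rewrite (le_trans x1)// lerDl.
have xs0 : 0 < x + s by exact: lt_le_trans xs1.
have g0 := Gamma_gt0 x1; have p0 := powR_gt0 s x0.
rewrite /gamma_ratio; apply/andP; split; last first.
  by rewrite ler_pdivrMr ?mulr_gt0// mul1r mulrC Gamma_le.
have h : x * Gamma x <= (x + s) `^ (1 - s) * Gamma (x + s).
  rewrite -GammaS// [x + 1](_ : _ = x + s + (1 - s)); last by ring.
  by apply: Gamma_le => //; rewrite subr_ge0 s1 gerBl.
rewrite ler_pdivlMr ?mulr_gt0// mulrAC ler_pdivrMr//.
have -> : x * (Gamma x * x `^ s) = x * Gamma x * x `^ s by rewrite mulrA.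
apply: (le_trans (ler_wpM2r (ltW p0) h)).
rewrite mulrAC [leRHS]mulrC ler_wpM2r ?(ltW (Gamma_gt0 _))//.
rewrite [leRHS](_ : _ = (x + s) `^ (1 - s) * (x + s) `^ s); last first.
  by rewrite -powRD ?subrK ?powRr1 ?(ltW xs0)// oner_eq0.
by rewrite ler_wpM2l ?powR_ge0// ge0_ler_powR// ?nnegrE ?(ltW x0) ?lerDl// ltW.
Qed.

Lemma cvg_divDy s : x / (x + s) @[x --> +oo] --> (1 : R).
Proof.
have h : x + s @[x --> +oo] --> (+oo : set_system R).
  apply/cvgryPge => A; apply: filterS (nbhs_pinfty_ge (num_real (A - s))) => x.
  by rewrite lerBlDr.
have c : (x + s)^-1 @[x --> +oo] --> (0 : R).
  apply/gtr0_cvgV0 => //; apply: filterS (nbhs_pinfty_gt (num_real (- s))) => x.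
  by rewrite -subr_gt0 opprK.
have : 1 - s * (x + s)^-1 @[x --> +oo] --> (1 - s * 0 : R).
  by apply: cvgB; [exact: cvg_cst|apply: cvgM; [exact: cvg_cst|exact: c]].
rewrite mulr0 subr0; apply: cvg_trans; apply: near_eq_cvg.
apply: filterS (nbhs_pinfty_gt (num_real (- s))) => x xs.
have xs0 : x + s != 0 by rewrite gt_eqF// -[s]opprK subr_gt0.
by rewrite -{1}(divff xs0) -mulrBl addrK.
Qed.

Lemma gamma_ratioS s x : 0 <= s -> 1 <= x ->
  gamma_ratio (s + 1) x = gamma_ratio s x * (x / (x + s))^-1.
Proof.
move=> s0 x1; have x0 : 0 < x by exact: lt_le_trans x1.
have xs1 : 1 <= x + s by rewrite (le_trans x1)// lerDl.
have xs0 : 0 < x + s by exact: lt_le_trans xs1.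
rewrite /gamma_ratio addrA GammaS// powRD; last first.
  by rewrite gt_eqF// ltr_wpDl.
rewrite powRr1 ?(ltW x0)//; field.
by rewrite !gt_eqF// ?powR_gt0 ?Gamma_gt0.
Qed.

(** Induction on an integer bound for [s]: squeezing on [0, 1], then [gamma_ratioS] lowers [s] by
    1. *)
Lemma gamma_ratio_cvg s : 0 <= s -> gamma_ratio s x @[x --> +oo] --> (1 : R).
Proof.
move=> s0; have [n sn] : exists n, s <= n.+1%:R.
  by exists (Num.bound s); rewrite ltW// (lt_trans (archi_boundP s0))// ltr_nat.
elim: n s s0 sn => [|n IH] s s0 sn.
  apply: (@squeeze_cvgr _ _ _ _ (fun x => x / (x + s)) (cst 1)).
  - apply: filterS (nbhs_pinfty_ge (num_real 1)) => x x1.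
    by apply: gamma_ratio_bounds => //; rewrite s0.
  - exact: cvg_divDy.
  - exact: cvg_cst.
have [s1|s1] := leP s n.+1%:R; first exact: IH.
have s1' : 1 <= s by rewrite (le_trans _ (ltW s1))// ler1n.
have s1'' : 0 <= s - 1 by rewrite subr_ge0.
have : gamma_ratio (s - 1) x * (x / (x + (s - 1)))^-1 @[x --> +oo] --> (1 * 1^-1 : R).
  apply: cvgM; first by apply: IH => //; rewrite lerBlDr natr1.
  by apply: cvgV; [exact: oner_neq0|exact: cvg_divDy].
rewrite invr1 mulr1; apply: cvg_trans; apply: near_eq_cvg.
apply: filterS (nbhs_pinfty_ge (num_real 1)) => x x1.
by rewrite -gamma_ratioS// subrK.
Qed.

End gamma_ratio.

(** * Determinacy of moment sequences with geometric growth *)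

Section determinacy.
Variable R : realType.
Implicit Types (mu nu : {measure set (measurableTypeR R) -> \bar R}) (m : nat -> R).

(** Every term of 1 + r + ... + r^(n-1) is at least r^n, and this sum times 1 - r is 1 - r^n. *)
Lemma natr_mul_expr_le (r : R) n : 0 <= r -> r <= 1 ->
  n%:R * r ^+ n * (1 - r) <= 1 - r ^+ n.
Proof.
move=> r0 r1; elim: n => [|n IH]; first by rewrite !mul0r expr0 subrr.
have r1' : 0 <= 1 - r by rewrite subr_ge0.
have h := ler_wpM2l r0 IH.
have h2 : 0 <= (1 - r) * (1 - r ^+ n.+1) by rewrite mulr_ge0// subr_ge0 exprn_ile1.
rewrite -[n.+1%:R]natr1 exprS; rewrite exprS in h2; nra.
Qed.

(** The outer exponent is chosen so that its product with (t / B)^(2N) is about N (t / x)^(2N),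
    which tends to 0 for t < x and to infinity for t >= x; the factor N settles t = x. The doubled
    inner exponent leaves a spare (t / x)^N for the estimate when t < x. *)
Definition steep_poly (B x : R) (N : nat) : {poly R} :=
  (1 - (B^-1 *: 'X) ^+ (N.*2)) ^+ Num.truncn (N%:R * (B / x) ^+ N.*2).

Lemma horner_steep_poly B x N t : (steep_poly B x N).[t] =
  (1 - (t / B) ^+ (N.*2)) ^+ Num.truncn (N%:R * (B / x) ^+ N.*2).
Proof. by rewrite /steep_poly !hornerE mulrC. Qed.

Lemma steep_poly_bound B x N t : 0 < B -> 0 <= t <= B ->
  0 <= (steep_poly B x N).[t] <= 1.
Proof.
move=> B0 /andP[t0 tB]; rewrite horner_steep_poly.
have y0 : 0 <= t / B by rewrite divr_ge0// ltW.
have y1 : t / B <= 1 by rewrite ler_pdivrMr// mul1r.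
have z0 : 0 <= 1 - (t / B) ^+ N.*2 by rewrite subr_ge0 exprn_ile1.
by rewrite exprn_ge0//= exprn_ile1// gerBl exprn_ge0.
Qed.

Lemma steep_poly_cvg (B x t : R) : 0 < B -> 0 < x -> 0 <= t <= B ->
  (steep_poly B x N).[t] @[N --> \oo] --> ((t < x)%R%:R : R).
Proof.
move=> B0 x0 /andP[t0 tB]; under eq_fun do rewrite horner_steep_poly.
have y0 : 0 <= t / B by rewrite divr_ge0// ltW.
have y1 : t / B <= 1 by rewrite ler_pdivrMr// mul1r.
have z0 : 0 < B / x by rewrite divr_gt0.
have yz : t / B * (B / x) = t / x by rewrite mulrA divfK// gt_eqF.
set y := t / B in y0 y1 yz *; set z := B / x in z0 yz *.
have a0 N : 0 <= y ^+ N.*2 by rewrite exprn_ge0.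
have a1 N : y ^+ N.*2 <= 1 by rewrite exprn_ile1.
have e0 N : 0 <= N%:R * z ^+ N.*2 by rewrite mulr_ge0// exprn_ge0// ltW.
have E1 N := truncn_itv (e0 N).
pose E N := Num.truncn (N%:R * z ^+ N.*2).
have [tx|xt] := ltP t x => /=.
  have r0 : 0 <= t / x by rewrite divr_ge0// ltW.
  have r1 : t / x < 1 by rewrite ltr_pdivrMr// mul1r.
  (* Bernoulli's inequality, with N r^(2N) <= r^N / (1 - r) for r = t / x. *)
  apply: (@squeeze_cvgr _ _ _ _ (fun N => 1 - (1 - t / x)^-1 * (t / x) ^+ N) (cst 1)).
  - apply: nearW => N; apply/andP; split; last first.
      by rewrite exprn_ile1 ?subr_ge0// gerBl.
    have bern k (a : R) : 0 <= a -> a <= 1 -> 1 - k%:R * a <= (1 - a) ^+ k.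
      move=> a0' a1'; elim: k => [|k IH]; first by rewrite mul0r subr0 expr0.
      have := ler_wpM2l (_ : 0 <= 1 - a) IH; rewrite subr_ge0 => /(_ a1') h.
      rewrite exprS (le_trans _ h)// -[k.+1%:R]natr1.
      have : 0 <= k%:R * a ^+ 2 by rewrite mulr_ge0// exprn_ge0.
      by rewrite expr2; nra.
    apply: le_trans (bern _ _ (a0 N) (a1 N)); rewrite lerD2l lerN2.
    have /andP[EN _] := E1 N.
    apply: (le_trans (ler_wpM2r (a0 N) EN)).
    rewrite -mulrA -exprMn mulrC [z * _]mulrC yz.
    rewrite -addnn exprD mulrC mulrA ler_wpM2r ?exprn_ge0//.
    rewrite -[leRHS]mul1r ler_pdivlMr ?subr_gt0//.
    by rewrite (le_trans (natr_mul_expr_le _ r0 (ltW r1)))// gerBl exprn_ge0.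
  - rewrite -[X in _ --> X](subr0 1) -[X in _ --> _ - X](mulr0 (1 - t / x)^-1).
    apply: cvgB; first exact: cvg_cst.
    apply: cvgM; first exact: cvg_cst.
    by apply: cvg_expr; rewrite ger0_norm.
  - exact: cvg_cst.
(* Here 1 - v <= e^(-v) is used; truncating the exponent loses less than one unit, whence the factor
   [expR 1]. *)
apply: (@squeeze_cvgr _ _ _ _ (cst 0) (fun N => expR 1 * expR (- N%:R))).
- apply: nearW => N; rewrite exprn_ge0 ?subr_ge0//=.
  apply: (@le_trans _ _ (expR (- y ^+ N.*2) ^+ E N)).
    by apply: lerXn2r; rewrite ?nnegrE ?subr_ge0 ?expR_ge0//; exact: expR_ge1Dx.
  rewrite -expRM_natr -expRD ler_expR mulNr lerNl opprB lerBlDr.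
  have /andP[_ EN] := E1 N.
  have h := ler_wpM2r (a0 N) (ltW EN).
  have h2 : N%:R <= N%:R * z ^+ N.*2 * y ^+ N.*2.
    rewrite -mulrA -exprMn [z * _]mulrC yz ler_peMr// exprn_ege1//.
    by rewrite ler_pdivlMr// mul1r.
  apply: (le_trans h2); apply: (le_trans h).
  by rewrite -natr1 mulrDl mul1r mulrC lerD2l.
- exact: cvg_cst.
- rewrite -[X in _ --> X](mulr0 (expR 1)); apply: cvgM; first exact: cvg_cst.
  exact: cvgn_expR.
Qed.

(** * Measures whose n-th moments are bounded by B^n *)

Section support.
Variables (m : nat -> R) (B : R).
Hypotheses (B0 : 0 < B) (mB : forall n, m n <= B ^+ n).

Let mitv (i : interval R) : measurable ([set` i] : set (measurableTypeR R)).
Proof. exact: measurable_itv. Qed.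

(** Markov's inequality: for y > B, y^n times the mass of [[y, +oo[] is at most m n <= B^n, and (B /
    y)^n tends to 0. *)
Lemma stieltjes_tail0 mu : stieltjes_represents mu m -> mu `]B, +oo[%classic = 0%E.
Proof.
move=> [_ mum].
have tail (y : R) : B < y -> mu `[y, +oo[%classic = 0%E.
  move=> By; have y0 := lt_trans B0 By.
  have tl n : (((y ^+ n)%:E * mu `[y, +oo[%classic) <= (B ^+ n)%:E)%E.
    rewrite -integral_cst//.
    apply: (@le_trans _ _ (\int[mu]_(x in `[y, +oo[) (x ^+ n)%:E)%E).
      apply: ge0_le_integral => //=.
      - by move=> x _; rewrite lee_fin exprn_ge0// ltW.
      - by apply/measurable_EFinP; apply: measurable_funX; exact: measurable_id.
      - move=> x; rewrite in_itv/= andbT => yx; rewrite lee_fin.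
        by rewrite lerXn2r// nnegrE (ltW y0, le_trans (ltW y0) yx).
    apply: (@le_trans _ _ (\int[mu]_(x in `[0%R, +oo[) (x ^+ n)%:E)%E).
      apply: ge0_subset_integral => //; try exact: mitv.
      - by apply/measurable_EFinP; apply: measurable_funX; exact: measurable_id.
      - by move=> x; rewrite /= in_itv/= andbT => x0; rewrite lee_fin exprn_ge0.
      - move=> x; rewrite /= !in_itv/= !andbT; exact/le_trans/ltW.
    by rewrite mum lee_fin.
  (* The case n = 0 shows that the tail mass is finite, hence a real number. *)
  have := tl 0%N; rewrite !expr0 mul1e => p1.
  have p0 : (0 <= mu `[y, +oo[%classic)%E by exact: measure_ge0.
  move: p0 p1 tl; case: (mu _) => [p| |]//; rewrite !lee_fin => p0 p1 tl.
  congr EFin; apply/eqP; rewrite eq_le p0 andbT.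
  have c : (B / y) ^+ n @[n --> \oo] --> (0 : R).
    apply: cvg_expr; rewrite ger0_norm ?divr_ge0 ?(ltW B0) ?(ltW y0)//.
    by rewrite ltr_pdivrMr// mul1r.
  rewrite -(cvg_lim _ c)//; apply: limr_ge; first by apply/cvg_ex; exists 0.
  apply: nearW => n; rewrite expr_div_n ler_pdivlMr ?exprn_gt0// mulrC.
  by have := tl n; rewrite -EFinM lee_fin.
rewrite (itvoyEbigcup B); apply: measure_negligible.
  by apply: bigcupT_measurable => k; exact: mitv.
apply: negligible_bigcup => k; apply/negligibleP; first exact: mitv.
by apply: tail; rewrite ltrDl invr_gt0.
Qed.

Lemma stieltjes_integral_compact mu (f : R -> R) : stieltjes_represents mu m ->
  measurable_fun setT f -> (forall x, 0 <= x -> 0 <= f x) ->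
  (\int[mu]_(x in `[0%R, +oo[) (f x)%:E = \int[mu]_(x in `[0%R, B]) (f x)%:E)%E.
Proof.
move=> mum mf f0.
have mf' : measurable_fun (`[0, +oo[%classic : set (measurableTypeR R)) (EFin \o f).
  by apply/measurable_EFinP; exact: measurable_funTS.
have f0' (x : measurableTypeR R) : `[0, +oo[%classic x -> (0 <= (EFin \o f) x)%E.
  by rewrite /= in_itv/= andbT => x0; rewrite lee_fin f0.
rewrite (ge0_negligible_integral (mitv _) (mitv _) mf' f0' (stieltjes_tail0 mum)).
congr (integral _ _ _); apply/seteqP; split => x /=; rewrite !in_itv/= !andbT.
  by move=> [-> /negP]; rewrite -leNgt.
by move=> /andP[-> xB]; split => //; apply/negP; rewrite -leNgt.
Qed.

Let D : set (measurableTypeR R) := `[0, B]%classic.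

Lemma stieltjes_mass mu : stieltjes_represents mu m -> mu D = (m 0%N)%:E.
Proof.
move=> mum; have [_ /(_ 0%N) <-] := mum.
rewrite (@stieltjes_integral_compact _ (fun x => x ^+ 0) mum)//.
under eq_integral do rewrite expr0.
by have := @integral_cst _ _ R mu D (mitv _) 1%E; rewrite mul1e => <-.
Qed.

Lemma stieltjes_setI mu (A : set (measurableTypeR R)) : stieltjes_represents mu m ->
  measurable A -> mu (A `&` D) = mu A.
Proof.
move=> mum mA; have mD : measurable D by exact: mitv.
rewrite [RHS](measureDI _ mA mD) [X in _ = (X + _)%E](_ : _ = 0%E) ?add0e//.
apply: measure_negligible; first exact: measurableD.
apply: (@negligibleS _ _ _ mu
  (`]-oo, 0[%classic `|` `]B, +oo[%classic : set (measurableTypeR R))).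
  move=> x [_] /=; rewrite !in_itv/= => /negP; rewrite negb_and -!ltNge andbT.
  by move=> /orP[]; [left|right].
apply: negligibleU; apply/negligibleP; try exact: mitv.
  by have [] := mum.
exact: stieltjes_tail0.
Qed.

Lemma stieltjes_bounded_integrable mu (f : R -> R) (C : R) : stieltjes_represents mu m ->
  measurable_fun D f -> (forall x, D x -> `|f x| <= C) -> mu.-integrable D (EFin \o f).
Proof.
move=> mum mf fC; apply: measurable_bounded_integrable => //.
- exact: mitv.
- by rewrite stieltjes_mass// ltry.
- by exists C; split; [exact: num_real|move=> M CM x Dx]; exact: le_trans (fC x Dx) (ltW CM).
Qed.

Lemma stieltjes_poly mu (p : {poly R}) : stieltjes_represents mu m ->
  mu.-integrable D (EFin \o (fun x => p.[x])) /\
  \int[mu]_(x in D) p.[x] = \sum_(i < size p) p`_i * m i.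
Proof.
move=> mum; have mD : measurable D by exact: mitv.
have iX n : mu.-integrable D (EFin \o (fun x => x ^+ n)).
  apply: (@stieltjes_bounded_integrable _ _ (B ^+ n)) => //.
  move=> x; rewrite /D/= in_itv/= => /andP[x0 xB].
  by rewrite ger0_norm ?exprn_ge0// lerXn2r ?nnegrE// ltW.
have iZ (i : 'I_(size p)) : mu.-integrable D (EFin \o (fun x => p`_i * x ^+ i)).
  by have := integrableZl mD p`_i (iX i); apply: eq_integrable.
have [i1 i2] := Rintegral_sum (index_enum _) mD iZ.
have -> : (fun x => p.[x]) = fun x => \sum_(i < size p) p`_i * x ^+ i.
  by apply/funext => x; rewrite horner_coef.
split => //; rewrite i2; apply: eq_bigr => i _; rewrite RintegralZl//; congr (_ * _).
rewrite /Rintegral -(stieltjes_integral_compact mum); last first.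
- by move=> x x0; rewrite exprn_ge0.
- by apply: measurable_funX; exact: measurable_id.
by have [_ ->] := mum.
Qed.

(** Dominated convergence on [D] by the constant 1, whose integral is the finite mass [m 0]. *)
Lemma steep_poly_integral mu (x : R) : stieltjes_represents mu m -> 0 < x ->
  (\int[mu]_(t in D) (steep_poly B x N).[t])%:E @[N --> \oo] --> mu `]-oo, x[%classic.
Proof.
move=> mum x0; have mD : measurable D by exact: mitv.
have Dt t : D t -> 0 <= t <= B by rewrite /D/= in_itv.
have mE : (fun t : R => (t < x)%R%:R) = \1_(`]-oo, x[%classic) :> (R -> R).
  apply/funext => t; rewrite indicE; congr (_%:R); congr nat_of_bool.
  by apply/idP/idP; rewrite inE/= in_itv.
have := @dominated_convergence _ _ R mu D mD
  (fun N t => ((steep_poly B x N).[t])%:E) (fun t => ((t < x)%R%:R)%:E) (cst 1%E).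
case.
- by move=> N; have [/integrableP[]] := stieltjes_poly (steep_poly B x N) mum.
- by rewrite -[fun t => _]/(EFin \o (fun t : R => (t < x)%R%:R)) mE; apply/measurable_EFinP; exact: measurable_indic.
- apply: aeW => t /Dt t0B; apply: cvg_EFin; first by apply: nearW.
  exact: steep_poly_cvg.
- apply: (@stieltjes_bounded_integrable _ (cst 1) 1) => // t _.
  by rewrite normr1.
- apply: aeW => t N /Dt t0B /=; have /andP[h1 h2] := steep_poly_bound x N B0 t0B.
  by rewrite lee_fin ger0_norm.
move=> _ _; rewrite [X in _ --> X](_ : _ = mu `]-oo, x[%classic); last first.
  rewrite -[fun t => _]/(EFin \o (fun t : R => (t < x)%R%:R)) mE.
  by rewrite integral_indic ?stieltjes_setI//; exact: mitv.
apply: cvg_trans; apply: near_eq_cvg; apply: nearW => N /=.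
rewrite fineK//; apply: integrable_fin_num => //.
by have [] := stieltjes_poly (steep_poly B x N) mum.
Qed.

(** Integrals of polynomials over [D] depend on [m] alone, so [steep_poly_integral] makes both
    measures agree on []-oo, x[] for x > 0; for x <= 0 both vanish there. These half-lines form a
    generating family stable under intersection. *)
Theorem stieltjes_bounded_unique mu nu : stieltjes_represents mu m ->
  stieltjes_represents nu m ->
  forall A : set (measurableTypeR R), measurable A -> mu A = nu A.
Proof.
move=> mum num A mA.
have E (x : R) : mu `]-oo, x[%classic = nu `]-oo, x[%classic.
  have [x0|x0] := leP x 0.
    have z (l : {measure set (measurableTypeR R) -> \bar R}) :
        stieltjes_represents l m -> l `]-oo, x[%classic = 0%E.
      move=> [l0 _]; apply: measure_negligible; first exact: mitv.
      apply: (@negligibleS _ _ _ l (`]-oo, 0[%classic : set (measurableTypeR R))).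
        by move=> t /=; rewrite !in_itv/= => /lt_le_trans; apply.
      by apply/negligibleP => //; exact: mitv.
    by rewrite !z.
  have h1 := steep_poly_integral mum x0; have h2 := steep_poly_integral num x0.
  have e N : (\int[mu]_(t in D) (steep_poly B x N).[t])%:E =
      (\int[nu]_(t in D) (steep_poly B x N).[t])%:E.
    by rewrite (stieltjes_poly _ mum).2 (stieltjes_poly _ num).2.
  rewrite (funext e) in h1.
  exact: cvg_unique h1 h2.
apply: (@measure_unique _ R (measurableTypeR R) (@RGenInftyO.G R)
  (fun k => `]-oo, k%:R[%classic)) => //.
- exact: RGenInftyO.measurableE.
- move=> X Y [x ->] [y ->]; exists (Num.min x y).
  apply/seteqP; split => t /=; rewrite !in_itv/= lt_min; first by case=> -> ->.
  by move=> /andP[].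
- by move=> k; exists k%:R.
- apply/seteqP; split => // t _; exists (Num.bound t) => //=.
  rewrite in_itv/=; have [t0|t0] := leP 0 t; first exact: archi_boundP.
  by rewrite (lt_le_trans t0).
- by move=> X [x ->].
- move=> k; apply: (@le_lt_trans _ _ (mu D)); last by rewrite stieltjes_mass// ltry.
  rewrite -[leLHS](stieltjes_setI mum); last exact: mitv.
  apply: le_measure; rewrite ?inE; last exact: subIsetr.
    by apply: measurableI; exact: mitv.
  exact: mitv.
Qed.

End support.
End determinacy.

(** * Binomial coefficients at real arguments *)

Section gamma_binomial.
Variable R : realType.
Variable k : nat.
Hypothesis k0 : (0 < k)%N.
Implicit Types (s h c : R).

Definition gbin s : R :=
  Gamma (k.+1%:R * s + 1) / (Gamma (s + 1) * Gamma (k%:R * s + 1)).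

(** The quotient gbin (s + 1) / gbin s, after cancelling the last numerator factor (k+1) s + (k+1)
    against s + 1. *)
Definition gbin_step s : R :=
  k.+1%:R * \prod_(i < k) ((k.+1%:R * s + i.+1%:R) / (k%:R * s + i.+1%:R)).

(** The growth rate (k+1)^(k+1) / k^k, written as the limit of [gbin_step] at infinity. *)
Definition gbin_base : R := k.+1%:R * (k.+1%:R / k%:R) ^+ k.

Lemma gbin_base_gt0 : 0 < gbin_base.
Proof. by rewrite mulr_gt0// exprn_gt0// divr_gt0// ltr0n. Qed.

Lemma Gamma_addn (x : R) n : 1 <= x ->
  Gamma (x + n%:R) = Gamma x * \prod_(i < n) (x + i%:R).
Proof.
move=> x1; elim: n => [|n IH]; first by rewrite addr0 big_ord0 mulr1.
rewrite -natr1 addrA GammaS; last by rewrite (le_trans x1)// lerDl.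
by rewrite IH big_ord_recr/= mulrC mulrA.
Qed.

Let lin1 (a : nat) s : 0 <= s -> 1 <= a%:R * s + 1.
Proof. by move=> s0; rewrite lerDr mulr_ge0. Qed.

Lemma gbin_gt0 s : 0 <= s -> 0 < gbin s.
Proof.
move=> s0; rewrite divr_gt0 ?mulr_gt0 ?Gamma_gt0 ?lin1//.
by rewrite lerDr.
Qed.

Lemma gbin_step_gt0 s : 0 <= s -> 0 < gbin_step s.
Proof.
move=> s0; rewrite mulr_gt0// prodr_gt0// => i _.
by rewrite divr_gt0// ltr_wpDl// mulr_ge0.
Qed.

Let step_identity (g1 g2 g3 a b y z : R) : g2 != 0 -> g3 != 0 -> b != 0 -> y != 0 ->
  g1 * (a * (z * y)) / (y * g2 * (g3 * b)) = g1 / (g2 * g3) * (z * (a / b)).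
Proof. by move=> *; field; do ?(apply/andP; split). Qed.

Let frac_identity (u v a b : R) : u != 0 -> a != 0 -> b != 0 ->
  v / u = a / b * ((v / a) / (u / b)).
Proof. by move=> *; field; do ?(apply/andP; split). Qed.

Let quot_identity (g1 g2 g3 h1 h2 h3 p1 p2 q1 q2 : R) :
  [/\ g1 != 0, g2 != 0, g3 != 0, h1 != 0 & h2 != 0] ->
  [/\ h3 != 0, p1 != 0, p2 != 0, q1 != 0 & q2 != 0] ->
  g1 / (g2 * g3) / (h1 / (h2 * h3)) =
  g1 / (h1 * (p1 * p2)) / (g2 / (h2 * q1) * (g3 / (h3 * q2))) *
  (p1 / q1 * (p2 / q2)).
Proof. by move=> [? ? ? ? ?] [? ? ? ? ?]; field; do ?(apply/andP; split). Qed.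

Lemma gbinS s : 0 <= s -> gbin (s + 1) = gbin s * gbin_step s.
Proof.
move=> s0.
have E a : a%:R * (s + 1) + 1 = a%:R * s + 1 + a%:R :> R by ring.
rewrite /gbin !E !Gamma_addn ?lin1// GammaS ?lerDr//.
rewrite [\prod_(i < k.+1) _]big_ord_recr/= /gbin_step.
have P a : \prod_(i < k) (a%:R * s + 1 + i%:R) =
    \prod_(i < k) (a%:R * s + i.+1%:R) :> R.
  by apply: eq_bigr => i _; rewrite -addrA nat1r.
rewrite !P prodf_div.
set A := \prod_(i < k) _; set B := \prod_(i < k) _.
have B0 : B != 0.
  by rewrite gt_eqF// prodr_gt0// => i _; rewrite ltr_wpDl// mulr_ge0.
have -> : k.+1%:R * s + 1 + k%:R = k.+1%:R * (s + 1) by rewrite -addrA nat1r; ring.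
by rewrite step_identity// ?gt_eqF ?Gamma_gt0 ?lin1 ?lerDr ?ltr_wpDl.
Qed.

Lemma gbin0 : gbin 0 = 1.
Proof. by rewrite /gbin !mulr0 add0r Gamma1 mulr1 divff. Qed.

Lemma gbinDn s N : 0 <= s ->
  gbin (s + N%:R) = gbin s * \prod_(i < N) gbin_step (s + i%:R).
Proof.
move=> s0; elim: N => [|N IH]; first by rewrite addr0 big_ord0 mulr1.
by rewrite -natr1 addrA gbinS ?addr_ge0// IH big_ord_recr/= mulrA.
Qed.

Lemma gbin_nat n : gbin n%:R = binom_seq R k n.
Proof.
rewrite /gbin /binom_seq -!natrM !natr1 !Gamma_nat.
have nk : (n <= k.+1 * n)%N by rewrite leq_pmull.
rewrite -(bin_fact nk) (_ : k.+1 * n - n = k * n)%N; last by rewrite mulSn addKn.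
by rewrite !natrM mulfK// mulf_neq0// pnatr_eq0 -lt0n fact_gt0.
Qed.

(** Partial products of Euler type for gbin s / M^s with M = [gbin_base]; by telescoping they equal
    gbin s times gbin N / gbin (s + N). *)
Definition gbin_prod N s : R :=
  \prod_(i < N) (gbin_step i%:R / gbin_step (s + i%:R)).

Lemma gbin_prodE N s : 0 <= s ->
  gbin_prod N s = gbin s / (gbin (s + N%:R) / gbin N%:R).
Proof.
move=> s0; rewrite gbinDn// -[in gbin N%:R](add0r N%:R) gbinDn// gbin0 mul1r.
rewrite /gbin_prod prodf_div; under [X in X / _ = _]eq_bigr do rewrite -[_%:R]add0r.
have h t : 0 <= t -> \prod_(i < N) gbin_step (t + i%:R) != 0 :> R.
  by move=> t0; rewrite gt_eqF// prodr_gt0// => i _; rewrite gbin_step_gt0// addr_ge0.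
by field; rewrite !h//= gt_eqF// gbin_gt0.
Qed.

Lemma cvg_powR (T : Type) (F : set_system T) (FF : Filter F) (u : T -> R) (l c : R) :
  0 < l -> u x @[x --> F] --> l -> u x `^ c @[x --> F] --> l `^ c.
Proof.
move=> l0 ul; apply: (@continuous_cvg _ _ _ _ FF u (fun y => y `^ c)) => //.
apply/differentiable_continuous/derivable1_diffP.
by apply: derivable_powR; rewrite in_itv/= l0.
Qed.

Let cvg_lin (a : nat) : (0 < a)%N -> a%:R * N%:R + 1 @[N --> \oo] --> (+oo : set_system R).
Proof.
move=> a0; apply/cvgryPge => A; near=> N.
apply: (@le_trans _ _ N%:R).
  by near: N; exact: nbhs_infty_ger.
by rewrite ler_wpDr// ler_peMl// ler1n.
Unshelve. all: by end_near. Qed.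

Let cvg_quot (a b : nat) : (0 < b)%N ->
  (a%:R * N%:R + 1) / (b%:R * N%:R + 1) @[N --> \oo] --> (a%:R / b%:R : R).
Proof.
move=> b0; have b0' : b%:R != 0 :> R by rewrite pnatr_eq0 -lt0n.
have p N : 0 < b%:R * N%:R + 1 :> R by rewrite ltr_wpDl// mulr_ge0.
have E N : (a%:R * N%:R + 1) / (b%:R * N%:R + 1) =
    a%:R / b%:R + (1 - a%:R / b%:R) * (b%:R * N%:R + 1)^-1 :> R.
  by field; rewrite b0' gt_eqF.
rewrite (funext E).
suff : a%:R / b%:R + (1 - a%:R / b%:R) * (b%:R * N%:R + 1)^-1 @[N --> \oo] -->
    (a%:R / b%:R + (1 - a%:R / b%:R) * 0 : R) by rewrite mulr0 addr0.
apply: cvgD; first exact: cvg_cst.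
apply: cvgM; first exact: cvg_cst.
by apply/gtr0_cvgV0; [apply: nearW|exact: cvg_lin].
Qed.

(** Each Gamma (a (s + N) + 1) is written as [gamma_ratio] times Gamma (a N + 1) times (a N + 1)^(a
    s). The Gamma values cancel, the ratios tend to 1, and (k+1) s = s + k s distributes the powers
    over quotients that tend to k + 1 and (k+1) / k. *)
Lemma gbin_quot_cvg s : 0 <= s ->
  gbin (s + N%:R) / gbin N%:R @[N --> \oo] --> gbin_base `^ s.
Proof.
move=> s0.
pose X (a : nat) (N : nat) : R := a%:R * N%:R + 1.
have X1 a N : 1 <= X a N by exact: lin1.
have X0 a N : 0 < X a N by exact: lt_le_trans (X1 a N).
have r a : (0 < a)%N -> gamma_ratio (a%:R * s) (X a N) @[N --> \oo] --> (1 : R).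
  move=> a0; apply: (@cvg_comp _ _ _ (X a) (gamma_ratio (a%:R * s))).
    exact: cvg_lin.
  by apply: gamma_ratio_cvg; rewrite mulr_ge0.
have E N : gbin (s + N%:R) / gbin N%:R =
    gamma_ratio (k.+1%:R * s) (X k.+1 N) /
    (gamma_ratio (1%:R * s) (X 1 N) * gamma_ratio (k%:R * s) (X k N)) *
    ((X k.+1 N / X 1 N) `^ s * (X k.+1 N / X k N) `^ (k%:R * s)).
  have A a : a%:R * (s + N%:R) + 1 = X a N + a%:R * s by rewrite /X; ring.
  rewrite /gbin !A -!/(X _ N) (_ : s + N%:R + 1 = X 1 N + 1%:R * s); last first.
    by rewrite /X; ring.
  rewrite (_ : N%:R + 1 = X 1 N); last by rewrite /X mul1r.
  rewrite /gamma_ratio.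
  have pd a : (X k.+1 N / X a N) `^ (a%:R * s) =
      X k.+1 N `^ (a%:R * s) / X a N `^ (a%:R * s).
    by rewrite powRM ?invr_ge0 ?(ltW (X0 _ _))// -powR_inv1 ?(ltW (X0 _ _))// -powRrM mulN1r powRN.
  rewrite -[s in (X k.+1 N / X 1 N) `^ s](mul1r s) !pd.
  rewrite (_ : X k.+1 N `^ (k.+1%:R * s) = X k.+1 N `^ (1%:R * s) * X k.+1 N `^ (k%:R * s)); last first.
    rewrite -powRD; last by rewrite (gt_eqF (X0 _ _)) implybT.
    by congr (_ `^ _); rewrite -[k.+1%:R]nat1r mulrDl.
  have G1 a : Gamma (X a N) != 0 by rewrite gt_eqF// Gamma_gt0.
  have G2 a : Gamma (X a N + a%:R * s) != 0.
    by rewrite gt_eqF// Gamma_gt0// (le_trans (X1 a N))// lerDl mulr_ge0.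
  have G3 a b : X a N `^ b != 0 by rewrite gt_eqF// powR_gt0.
  by rewrite (quot_identity (p1 := X k.+1 N `^ (1%:R * s)) (p2 := X k.+1 N `^ (k%:R * s))
    (q1 := X 1 N `^ (1%:R * s)) (q2 := X k N `^ (k%:R * s))).
under eq_fun do rewrite E.
have -> : gbin_base `^ s = (1 / (1 * 1)) *
    ((k.+1%:R / 1%:R) `^ s * (k.+1%:R / k%:R) `^ (k%:R * s)).
  rewrite mulr1 divr1 mul1r divr1 /gbin_base powRM ?exprn_ge0 ?divr_ge0//.
  by rewrite -powR_mulrn ?divr_ge0// -powRrM.
apply: cvgM; apply: cvgM.
- exact: r.
- by apply: cvgV; [rewrite mulr1 oner_neq0|apply: cvgM; exact: r].
- by apply: cvg_powR; [rewrite divr_gt0|exact: cvg_quot].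
- by apply: cvg_powR; [rewrite divr_gt0// ltr0n|exact: cvg_quot].
Qed.

Lemma gbin_prod_cvg s : 0 <= s ->
  gbin_prod N s @[N --> \oo] --> gbin s / gbin_base `^ s.
Proof.
move=> s0; under eq_fun do rewrite gbin_prodE//.
apply: cvgM; first exact: cvg_cst.
apply: cvgV; last exact: gbin_quot_cvg.
by rewrite gt_eqF// powR_gt0// gbin_base_gt0.
Qed.

Lemma gbin_step_homo s s' : 0 <= s -> s <= s' -> gbin_step s <= gbin_step s'.
Proof.
move=> s0 ss'; have s'0 := le_trans s0 ss'.
rewrite ler_wpM2l// ler_prod// => i _.
have p a t : 0 <= t -> 0 < a%:R * t + i.+1%:R :> R by move=> t0; rewrite ltr_wpDl// mulr_ge0.
rewrite divr_ge0 ?(ltW (p _ _ _))//=.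
rewrite ler_pdivrMr ?p// mulrAC ler_pdivlMr ?p// -subr_ge0.
have -> : (k.+1%:R * s' + i.+1%:R) * (k%:R * s + i.+1%:R) -
    (k.+1%:R * s + i.+1%:R) * (k%:R * s' + i.+1%:R) = i.+1%:R * (s' - s).
  by rewrite -[k.+1%:R]natr1; ring.
by rewrite mulr_ge0// subr_ge0.
Qed.

(** No factor of [gbin_prod N] increases with [s], and this passes to the limit. Continuity of Gamma
    will be replaced by this monotonicity. *)
Lemma gbin_noninc s s' : 0 <= s -> s <= s' ->
  gbin s' / gbin_base `^ s' <= gbin s / gbin_base `^ s.
Proof.
move=> s0 ss'; have s'0 := le_trans s0 ss'.
apply: (ler_cvg_to (gbin_prod_cvg s'0) (gbin_prod_cvg s0)); apply: nearW => N.
apply: ler_prod => i _.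
have p t : 0 <= t -> 0 < gbin_step (t + i%:R) by move=> t0; rewrite gbin_step_gt0// addr_ge0.
rewrite divr_ge0 ?(ltW (p _ _)) ?(ltW (gbin_step_gt0 _))//=.
rewrite ler_wpM2l ?(ltW (gbin_step_gt0 _))// lef_pV2 ?posrE ?p//.
by rewrite gbin_step_homo ?addr_ge0// lerD2r.
Qed.

Lemma powR_prod (I : Type) (r : seq I) (f : I -> R) c : (forall i, 0 <= f i) ->
  (\prod_(i <- r) f i) `^ c = \prod_(i <- r) f i `^ c.
Proof.
move=> f0; elim: r => [|i r IH]; first by rewrite !big_nil powR1.
by rewrite !big_cons powRM ?IH// prodr_ge0.
Qed.

Lemma gbin_cmono h c : 0 <= h -> 0 <= c ->
  cmono (fun n => (gbin (n%:R * h) / gbin_base `^ (n%:R * h)) `^ c).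
Proof.
move=> h0 c0; have nh n : 0 <= n%:R * h by rewrite mulr_ge0.
apply: (@cmono_cvg _ (fun N n => gbin_prod N (n%:R * h) `^ c)); last first.
  move=> n; apply: cvg_powR; last exact: gbin_prod_cvg.
  by rewrite divr_gt0 ?gbin_gt0// powR_gt0// gbin_base_gt0.
move=> N.
have E n : gbin_prod N (n%:R * h) `^ c = \prod_(m < N) (gbin_step m%:R / gbin_step (n%:R * h + m%:R)) `^ c.
  rewrite powR_prod// => m; rewrite divr_ge0// ltW// gbin_step_gt0//.
  by rewrite addr_ge0.
rewrite (funext E); apply: cmono_prod => m.
(* Up to sign, the zeros in s of the numerator and of the denominator of [gbin_step (s + m)];
   [a i <= b i] since k < k + 1. *)
pose a (i : 'I_k) : R := m%:R + i.+1%:R / k.+1%:R.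
pose b (i : 'I_k) : R := m%:R + i.+1%:R / k%:R.
have kn0 : k%:R != 0 :> R by rewrite pnatr_eq0 -lt0n.
have F n : (gbin_step m%:R / gbin_step (n%:R * h + m%:R)) `^ c =
    (gbin_step m%:R / k.+1%:R) `^ c *
    \prod_(i < k) ((k%:R / k.+1%:R) `^ c * ((b i + n%:R * h) / (a i + n%:R * h)) `^ c).
  have a0 i : 0 < a i + n%:R * h.
    by rewrite ltr_wpDr// ltr_wpDl// divr_gt0.
  have b0 i : 0 <= b i + n%:R * h by rewrite !addr_ge0// divr_ge0.
  under eq_bigr => i _ do rewrite -powRM ?divr_ge0 ?(ltW (a0 i))//.
  rewrite -powR_prod; last by move=> i; rewrite mulr_ge0// divr_ge0// ltW.
  rewrite -powRM; last 2 first.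
  - by rewrite divr_ge0// ltW// gbin_step_gt0.
  - by rewrite prodr_ge0// => i _; rewrite mulr_ge0// divr_ge0// ltW.
  congr (_ `^ _); rewrite {2}/gbin_step invfM -prodfV mulrA; congr (_ * _).
  apply: eq_bigr => i _; rewrite invf_div.
  have a0' : k.+1%:R * (n%:R * h + m%:R) + i.+1%:R != 0.
    by rewrite gt_eqF// ltr_wpDl// mulr_ge0// addr_ge0.
  have -> : a i + n%:R * h = (k.+1%:R * (n%:R * h + m%:R) + i.+1%:R) / k.+1%:R.
    by rewrite /a; field; rewrite nat1r pnatr_eq0.
  have -> : b i + n%:R * h = (k%:R * (n%:R * h + m%:R) + i.+1%:R) / k%:R.
    by rewrite /b; field.
  by apply: frac_identity => //; rewrite pnatr_eq0.
rewrite (funext F); apply: cmonoM; first by apply: cmono_cst; exact: powR_ge0.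
apply: cmono_prod => i; apply: cmonoM; first by apply: cmono_cst; exact: powR_ge0.
apply: cmono_powR_ratio => //; first by rewrite ltr_wpDl// divr_gt0.
by rewrite lerD2l ler_wpM2l// lef_pV2 ?posrE ?ltr0n// ler_nat.
Qed.

End gamma_binomial.

(** * Representing measures of the power sequences and their Mellin transforms *)

Section mellin.
Variable R : realType.
Variable k : nat.
Hypothesis k0 : (0 < k)%N.
Variable c : R.
Hypothesis c0 : 0 < c.

Let G (s : R) := gbin k s `^ c.
Let B : R := gbin_base R k `^ c.

Let B0 : 0 < B.
Proof. by rewrite powR_gt0// gbin_base_gt0. Qed.

Let baseE (s : R) : (gbin_base R k `^ s) `^ c = B `^ s.
Proof. by rewrite /B -!powRrM mulrC. Qed.

Let GE (s : R) : 0 <= s -> (gbin k s / gbin_base R k `^ s) `^ c = G s / B `^ s.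
Proof.
move=> s0; have p : 0 < gbin_base R k `^ s by rewrite powR_gt0// gbin_base_gt0.
rewrite powRM ?invr_ge0 ?(ltW p) ?(ltW (gbin_gt0 k s0))//; congr (_ * _).
by rewrite -powR_inv1 ?(ltW p)// -powRrM mulN1r powRN baseE.
Qed.

Let seqE n : binom_seq R k n `^ c = G n%:R.
Proof. by rewrite /G gbin_nat. Qed.

(** At step h = 1 the completely monotone sequence starts at 1 and does not increase. *)
Lemma binom_pow_le n : binom_seq R k n `^ c <= B ^+ n.
Proof.
rewrite seqE; have := cmono_le0 n (gbin_cmono k0 (@ler01 R) (ltW c0)).
rewrite mul0r mulr1 gbin0 powRr0 divr1 powR1 GE// ler_pdivrMr ?(powR_gt0 _ B0)//.
by rewrite mul1r powR_mulrn// ltW// B0.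
Qed.

(* The Hausdorff measure of the samples at step [1 / q] is pushed forward along
   [x |-> B * |x| ^+ q], so that [t `^ (p / q)] pulls back to the monomial
   [x ^+ p] up to a constant. *)
Lemma gbin_measure_exists (q : nat) : (0 < q)%N ->
  exists mu : {measure set (measurableTypeR R) -> \bar R},
    mu `]-oo, 0[%classic = 0%E /\
    forall p : nat, (\int[mu]_(t in `[0%R, +oo[) (t `^ (p%:R / q%:R))%:E =
      (G (p%:R / q%:R))%:E)%E.
Proof.
move=> q0; have q0' : q%:R != 0 :> R by rewrite pnatr_eq0 -lt0n.
have h0 : 0 <= q%:R^-1 :> R by rewrite invr_ge0.
have [|P [P0 PE]] := hausdorff_moment (gbin_cmono k0 h0 (ltW c0)).
  by rewrite mul0r gbin0 powRr0 divr1 powR1.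
(* On [0, 1] the absolute value disappears; elsewhere it keeps [phi] nonnegative, so that no mass
   reaches the negative half-line. *)
pose phi (x : measurableTypeR R) : measurableTypeR R := B * `|x| ^+ q.
have mphi : measurable_fun setT phi.
  have : measurable_fun setT (fun x : R => B * `|x| ^+ q).
    apply: measurable_funM => //; apply: measurable_funX.
    by apply: continuous_measurable_fun; exact: norm_continuous.
  exact.
have phi0 x : 0 <= phi x by rewrite mulr_ge0 ?exprn_ge0// ltW.
pose phi' : {mfun measurableTypeR R >-> measurableTypeR R} :=
  HB.pack phi (isMeasurableFun.Build _ _ _ _ phi mphi).
exists (pushforward P phi'); split.
  have e : phi @^-1` `]-oo, 0[%classic = set0.
    by apply/seteqP; split => // x /=; rewrite in_itv/= ltNge phi0.
  by transitivity (P (phi @^-1` `]-oo, 0[%classic)) => //; rewrite e measure0.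
move=> p; set s : R := p%:R / q%:R.
have s0 : 0 <= s by rewrite divr_ge0.
rewrite (ge0_integral_pushforward mphi)//; last 2 first.
- by apply/measurable_EFinP; apply: measurable_funTS; exact: measurable_powR.
- by move=> t _; rewrite lee_fin powR_ge0.
rewrite (_ : _ @^-1` _ = setT); last first.
  by apply/seteqP; split => // x _ /=; rewrite in_itv/= andbT phi0.
have mD : measurable (`[0, 1]%classic : set (measurableTypeR R)) by exact: measurable_itv.
have mf : measurable_fun setT (fun x => (phi x `^ s)%:E).
  apply/measurable_EFinP; apply: (measurableT_comp (measurable_powR s)) => //.
rewrite (@ge0_negligible_integral _ _ _ P _ (~` `[0, 1]%classic))//; last 2 first.
- exact: measurableC.
- by move=> x _; rewrite lee_fin powR_ge0.
rewrite setDE setCK setTI.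
have phiE x : `[0, 1]%classic x -> phi x `^ s = B `^ s * x ^+ p.
  rewrite /= in_itv/= => /andP[x0 _]; rewrite /phi powRM ?(ltW B0) ?exprn_ge0//.
  rewrite ger0_norm// -[x ^+ q]powR_mulrn// -powRrM (_ : q%:R * s = p%:R) ?powR_mulrn//.
  by rewrite /s mulrC divfK.
transitivity (\int[P]_(x in `[0%R, 1%R]) ((B `^ s)%:E * (x ^+ p)%:E))%E.
  by apply: eq_integral => x; rewrite inE => /phiE xE; rewrite -EFinM -xE.
rewrite ge0_integralZl//; last 3 first.
- by apply/measurable_EFinP; apply: measurable_funX; exact: measurable_id.
- by move=> x; rewrite /= in_itv/= => /andP[x0 _]; rewrite lee_fin exprn_ge0.
- by rewrite lee_fin powR_ge0.
rewrite PE -EFinM -/s GE//; congr EFin.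
by rewrite mulrC divfK// gt_eqF// powR_gt0.
Unshelve. all: exact: mphi. Qed.

Lemma gbin_measure_represents q (mu : {measure set (measurableTypeR R) -> \bar R}) :
  (0 < q)%N -> mu `]-oo, 0[%classic = 0%E ->
  (forall p : nat, (\int[mu]_(t in `[0%R, +oo[) (t `^ (p%:R / q%:R))%:E =
      (G (p%:R / q%:R))%:E)%E) ->
  stieltjes_represents mu (fun n => binom_seq R k n `^ c).
Proof.
move=> q0 mu0 muE; split => // n; rewrite seqE.
have q0' : q%:R != 0 :> R by rewrite pnatr_eq0 -lt0n.
have := muE (n * q)%N; rewrite natrM mulfK// => <-.
apply: eq_integral => x; rewrite inE/= in_itv/= andbT => x0.
by rewrite powR_mulrn.
Qed.

Lemma binom_pow_moment : stieltjes_moment_sequence (fun n => binom_seq R k n `^ c).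
Proof.
have [mu [mu0 muE]] := gbin_measure_exists (isT : (0 < 1)%N).
by exists mu; exact: gbin_measure_represents mu0 muE.
Qed.

Lemma binom_pow_determinate :
  stieltjes_determinate (fun n => binom_seq R k n `^ c).
Proof.
split; first exact: binom_pow_moment.
by move=> mu nu hmu hnu; exact: stieltjes_bounded_unique B0 binom_pow_le _ _ hmu hnu.
Qed.

Variable mu : {measure set (measurableTypeR R) -> \bar R}.
Hypothesis mum : stieltjes_represents mu (fun n => binom_seq R k n `^ c).

(** The measure built for the denominator [q] has the same integer moments as [mu], so determinacy
    identifies the two and its fractional moments carry over. *)
Lemma mellin_rational (p q : nat) : (0 < q)%N ->
  (\int[mu]_(t in `[0%R, +oo[) (t `^ (p%:R / q%:R))%:E = (G (p%:R / q%:R))%:E)%E.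
Proof.
move=> q0; have [nu [nu0 nuE]] := gbin_measure_exists q0.
have num := gbin_measure_represents q0 nu0 nuE.
rewrite -nuE; apply: eq_measure_integral => A mA _.
exact: (stieltjes_bounded_unique B0 binom_pow_le mum num).
Qed.

Let D : set (measurableTypeR R) := `[0, B]%classic.

Let mD : measurable D. Proof. exact: measurable_itv. Qed.

(** The base [B + 1] is at least 1, so its powers grow with the exponent and one bound serves all
    exponents up to [b]. *)
Let powR_bound (a b t : R) : 0 <= a -> a <= b -> D t -> `|t `^ a| <= (B + 1) `^ b.
Proof.
move=> a0 ab; rewrite /D/= in_itv/= => /andP[t0 tB].
rewrite ger0_norm ?powR_ge0// (@le_trans _ _ ((B + 1) `^ a))//.
  rewrite ge0_ler_powR// ?nnegrE// ?addr_ge0 ?(ltW B0)//.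
  by rewrite (le_trans tB)// lerDl.
by apply: ler_powR => //; rewrite lerDr ltW.
Qed.

Let powR_integrable (a : R) : 0 <= a -> mu.-integrable D (EFin \o (fun t => t `^ a)).
Proof.
move=> a0; apply: (@stieltjes_bounded_integrable _ _ B B0 binom_pow_le mu _ ((B + 1) `^ a)) => //.
- by apply: measurable_funTS; exact: measurable_powR.
- by move=> t; exact: powR_bound.
Qed.

Lemma mellin_compact (a : R) : 0 <= a ->
  (\int[mu]_(t in `[0%R, +oo[) (t `^ a)%:E = (\int[mu]_(t in D) (t `^ a))%:E)%E.
Proof.
move=> a0; rewrite (stieltjes_integral_compact B0 binom_pow_le mum).
- by rewrite /Rintegral fineK//; apply: integrable_fin_num => //; exact: powR_integrable.
- exact: measurable_powR.
- by move=> t _; exact: powR_ge0.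
Qed.

Lemma mellin_cvg (a : nat -> R) (s : R) : 0 < s -> (forall n, 0 <= a n <= s + 1) ->
  a n @[n --> \oo] --> s ->
  \int[mu]_(t in D) (t `^ (a n)) @[n --> \oo] --> \int[mu]_(t in D) (t `^ s).
Proof.
move=> s0 a0 acv.
have := @dominated_convergence _ _ R mu D mD
  (fun n t => (t `^ (a n))%:E) (fun t => (t `^ s)%:E) (cst ((B + 1) `^ (s + 1))%:E).
case.
- by move=> n; apply/measurable_EFinP; apply: measurable_funTS; exact: measurable_powR.
- by apply/measurable_EFinP; apply: measurable_funTS; exact: measurable_powR.
- apply: aeW => t; rewrite /D/= in_itv/= => /andP[t0 tB].
  apply: cvg_EFin; first by apply: nearW.
  (* At t = 0 the exponents are eventually positive, so the powers vanish like the limit; exponent 0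
     would give 0^0 = 1. *)
  have [->|tN0] := eqVneq t 0.
    rewrite powR0 ?gt_eqF//; apply: cvg_near_cst.
    apply: filterS (cvgr_gt s acv 0 s0) => n an.
    by rewrite /= powR0// gt_eqF.
  rewrite [_ \o _](_ : _ = fun n => t `^ a n)// /powR (negbTE tN0).
  apply: (@continuous_cvg _ _ _ _ _ (fun n => a n * ln t) expR); first exact: continuous_expR.
  by apply: cvgM => //; exact: cvg_cst.
- apply: (@stieltjes_bounded_integrable _ _ B B0 binom_pow_le mu _ ((B + 1) `^ (s + 1))) => //.
  by move=> t _; rewrite ger0_norm ?powR_ge0.
- apply: aeW => t n Dt; rewrite /= lee_fin; have /andP[a1 a2] := a0 n.
  exact: powR_bound.
move=> _ _; rewrite -[X in _ --> X]fineK; last first.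
  by apply: integrable_fin_num => //; exact/powR_integrable/ltW.
by move=> /fine_cvgP[_].
Qed.

(** The integral is continuous in the exponent by [mellin_cvg], while G(s) / B^s is nonincreasing;
    their equality at rationals on both sides of [s] forces equality at [s]. *)
Lemma mellin_transform (s : R) : 0 <= s ->
  (\int[mu]_(t in `[0%R, +oo[) (t `^ s)%:E = (G s)%:E)%E.
Proof.
(* The exponent 0 is the rational 0 / 1; [mellin_cvg] asks for a positive limit exponent. *)
rewrite le_eqVlt => /predU1P[<-|s0].
  by have := @mellin_rational 0 1 isT; rewrite mul0r.
rewrite mellin_compact ?(ltW s0)//; congr EFin.
pose I (a : R) := \int[mu]_(t in D) (t `^ a).
have IQ p q : (0 < q)%N -> I (p%:R / q%:R) = G (p%:R / q%:R).
  move=> q0; apply: EFin_inj; rewrite -mellin_compact ?divr_ge0//.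
  exact: mellin_rational.
(* Rational approximations from both sides: a n <= s < b n = a n + 1 / (n + 1). *)
pose p n := Num.truncn (s * n.+1%:R).
pose a n : R := (p n)%:R / n.+1%:R.
pose b n : R := (p n).+1%:R / n.+1%:R.
have ps n : (p n)%:R <= s * n.+1%:R < (p n).+1%:R.
  by apply: truncn_itv; rewrite mulr_ge0// ltW.
have as_ n : a n <= s by rewrite ler_pdivrMr//; have /andP[] := ps n.
have sb n : s < b n by rewrite ltr_pdivlMr//; have /andP[] := ps n.
have ba n : b n = a n + n.+1%:R^-1 by rewrite /b -natr1 mulrDl mul1r.
have a0 n : 0 <= a n by rewrite divr_ge0.
have inv1 n : n.+1%:R^-1 <= 1 :> R by rewrite invf_le1// ler1n.
have acv : a n @[n --> \oo] --> s.
  apply: (@squeeze_cvgr _ _ _ _ (fun n => s - n.+1%:R^-1) (cst s)).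
  - by apply: nearW => n; rewrite as_ andbT lerBlDr -ba ltW.
  - rewrite -[X in _ --> X](subr0 s); apply: cvgB; first exact: cvg_cst.
    exact: cvg_harmonic.
  - exact: cvg_cst.
have bcv : b n @[n --> \oo] --> s.
  rewrite (funext ba) -[X in _ --> X](addr0 s); apply: cvgD => //.
  exact: cvg_harmonic.
have Ia := mellin_cvg s0 (fun n => _) acv.
have Ib := mellin_cvg s0 (fun n => _) bcv.
have Bcv (u : nat -> R) : u n @[n --> \oo] --> s ->
    I (u n) @[n --> \oo] --> I s ->
    I (u n) / B `^ (u n) @[n --> \oo] --> I s / B `^ s.
  move=> us Iu; apply: cvgM => //; apply: cvgV; first by rewrite gt_eqF// powR_gt0.
  rewrite /powR gt_eqF//.
  apply: (@continuous_cvg _ _ _ _ _ (fun n => u n * ln B) expR); first exact: continuous_expR.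
  by apply: cvgM => //; exact: cvg_cst.
have mono x y : 0 <= x -> x <= y -> G y / B `^ y <= G x / B `^ x.
  move=> x0 xy; have y0 := le_trans x0 xy; rewrite -[leLHS](GE y0) -[leRHS](GE x0).
  have p' z : 0 <= z -> 0 <= gbin k z / gbin_base R k `^ z.
    by move=> z0; rewrite divr_ge0 ?powR_ge0// ltW// gbin_gt0.
  rewrite ge0_ler_powR ?nnegrE ?p' ?(ltW c0)//.
  exact: gbin_noninc.
suff : I s / B `^ s = G s / B `^ s.
  by move/divIf; apply; rewrite gt_eqF// powR_gt0.
(* The rationals b n > s give the upper bound for the integral, the rationals a n <= s the lower
   one. *)
apply/eqP; rewrite eq_le; apply/andP; split.
- apply: (ler_cvg_to (Bcv _ bcv (Ib _)) (cvg_cst _)).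
    move=> n; rewrite (le_trans (a0 n)) ?ba ?lerDl//=.
    by rewrite lerD.
  by apply: nearW => n; rewrite IQ//; apply: mono;
    [exact: ltW|exact/ltW/sb].
- have a1 n : 0 <= a n <= s + 1 by rewrite a0/= (le_trans (as_ n))// lerDl.
  have h := Bcv _ acv (Ia a1); rewrite -(cvg_lim _ h)//.
  apply: limr_ge; first by apply/cvg_ex; eexists; exact: h.
  by apply: nearW => n; rewrite IQ//; exact: (mono _ _ (a0 n) (as_ n)).
Qed.

End mellin.

Theorem theorem6 (R : realType) (k : nat) (hk : (2 <= k)%N) :
  [/\ infinitely_divisible_stieltjes (binom_seq R k),
      forall c : R, 0 < c ->
        stieltjes_determinate (fun n => binom_seq R k n `^ c)
    & forall (c : R) (mu : {measure set (measurableTypeR R) -> \bar R}),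
        0 < c ->
        stieltjes_represents mu (fun n => binom_seq R k n `^ c) ->
        forall s : R, 0 <= s ->
          (\int[mu]_(t in `[0%R, +oo[) (t `^ s)%:E =
           ((Gamma (k.+1%:R * s + 1) /
             (Gamma (s + 1) * Gamma (k%:R * s + 1))) `^ c)%:E)%E ].
Proof.
have k0 : (0 < k)%N by exact: ltnW.
split.
- split; last by move=> c c0; exact: binom_pow_moment.
  have [mu muE] := binom_pow_moment k0 (@ltr01 R).
  exists mu; have -> : binom_seq R k = fun n => binom_seq R k n `^ 1.
    by apply/funext => n; rewrite powRr1.
  exact: muE.
- by move=> c c0; exact: binom_pow_determinate.
- by move=> c mu c0 mum s s0; exact: (mellin_transform k0 c0 mum s0).
Qed.
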